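(* Let $r\geq 3$ and $0<c<\frac{1}{2}$. Then for $n$ sufficiently large, \[ ex_r(n;\mathcal{L}_{n,cn}^{(r)})=\binom{n}{r}-\binom{n-\frac{cn}{r}}{r}+o(n^r). \]
   Context: An $r$-graph is a hypergraph all of whose edges have exactly $r$ vertices. A tight path is an $r$-graph whose vertices can be ordered $v_1,\dots,v_m$ so that its edges are exactly $\{v_i,\dots,v_{i+r-1}\}$ for $i=1,\dots,m-r+1$. A tight linear forest is an $r$-graph each of whose connected components is a tight path or an isolated vertex. $\mathcal{L}_{n,k}^{(r)}$ is the family of all tight linear forests on $n$ vertices with $k$ edges. $ex_r(n;\mathcal{F})$ is the maximum number of edges in an $r$-graph on $n$ vertices containing no subgraph isomorphic to a member of $\mathcal{F}$. Quantities such as $cn$ and $cn/r$ are treated as integers (rounded); $o(n^r)$ is as $n\to\infty$ with $r,c$ fixed. *)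

(* Defs.v *)
From mathcomp Require Import all_boot all_order all_algebra.

Set Implicit Arguments.
Unset Strict Implicit.
Unset Printing Implicit Defensive.

Section Hypergraphs.
Variable V : finType.
Implicit Types (E : {set {set V}}) (C : {set V}) (s : seq V).

Definition rgraph (r : nat) E : bool := [forall e in E, #|e| == r].

Definition adjacent E : rel V :=
  fun x y => [exists e in E, (x \in e) && (y \in e)].

Definition component E (x : V) : {set V} :=
  [set y | connect (adjacent E) x y].

Definition edges_in E C : {set {set V}} := [set e in E | e \subset C].

(* With 0-based positions, the windows of length r of a sequence of length m
   start at the i with i <= m - r, i.e. i < m.+1 - r; there is none if m < r. *)
Definition windows (r : nat) s : {set {set V}} :=
  [set [set x in take r (drop i s)] | i : 'I_((size s).+1 - r)].

Definition tight_path (r : nat) C E : bool :=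
  [exists s : #|C|.-tuple V,
    [&& uniq s, [set x in s] == C & E == windows r s]].

Definition isolated_vertex C E : bool := (#|C| == 1) && (E == set0).

Definition tight_linear_forest (r : nat) E : bool :=
  rgraph r E &&
  [forall x, let C := component E x in
    tight_path r C (edges_in E C) || isolated_vertex C (edges_in E C)].

End Hypergraphs.

(* H is isomorphic to a (not necessarily induced) subgraph of G. *)
Definition contains_copy (W V : finType)
    (G : {set {set V}}) (H : {set {set W}}) : bool :=
  [exists f : {ffun W -> V}, injectiveb f && [forall e in H, f @: e \in G]].

Definition tight_linear_forests (r n k : nat) : {set {set {set 'I_n}}} :=
  [set H : {set {set 'I_n}} | tight_linear_forest r H & #|H| == k].

(* The members of the forbidden family share the vertex set 'I_m. *)
Definition turan (r n m : nat) (F : {set {set {set 'I_m}}}) : nat :=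
  \max_(G : {set {set 'I_n}} |
      rgraph r G && [forall H in F, ~~ contains_copy G H]) #|G|.

(* Main.v *)
(* Upper bound. Let [G] have no tight linear forest with [cn] edges. A one-sided
   regularity lemma splits the vertices into boundedly many classes so that all but
   [o(n^r)] edges lie in lower regular [r]-tuples of classes, in which tight paths
   of any fixed length can be removed greedily until little is left of each class.
   Consider the largest fractional packing of regular tuples into the classes. If its
   weight exceeds [(c + delta) n / r], then taking tight paths inside the tuples of the
   packing gives a tight linear forest with [cn] edges; a basic optimal solution uses
   at most as many tuples as there are classes, so that the leftovers are negligible.
   Otherwise, by linear programming duality, there are vertex weights of total less
   than [(c + delta) n / r] such that all but [o(n^r)] edges have weight at least 1.
   Frankl's proof of the matching bound then applies to the family of all [r]-sets of
   weight at least 1, as [c < 1/2]; such a threshold family needs no shifting.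

   Lower bound. A vertex of a tight linear forest lies in at most [r] edges, so the
   edges that meet a fixed set of fewer than [cn/r] vertices contain no tight linear
   forest with [cn] edges. *)
Require Import Defs.
From mathcomp Require Import all_boot all_order all_fingroup all_algebra.
From mathcomp Require Import ring lra zify.
Set Implicit Arguments.
Unset Strict Implicit.
Unset Printing Implicit Defensive.
Import Order.TTheory GRing.Theory Num.Theory.

(** * Linear programming *)

Section LinearProgramming.
Variable R : realFieldType.
Local Open Scope ring_scope.

(** Induction on the number of generators. If the separator [x0] of the first [m] generators fails
    on [g m], everything is projected along [g m] onto the hyperplane orthogonal to [x0], where the
    induction hypothesis applies. *)
Lemma farkas (I : finType) (m : nat) (g : nat -> I -> R) (b : I -> R) :
  (exists2 l : nat -> R, forall j, 0 <= l j &
     forall i, b i = \sum_(j < m) l j * g j i) \/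
  (exists2 x : I -> R, forall j, (j < m)%N -> \sum_i g j i * x i <= 0 &
     0 < \sum_i b i * x i).
Proof.
elim: m g b => [|m IHm] g b.
  case: (boolP [forall i, b i == 0]) => [/forallP b0|/forallPn[i bi0]].
    by left; exists (fun=> 0) => // i; rewrite big_ord0; apply/eqP.
  right; exists b => //; rewrite lt_neqAle eq_sym psumr_neq0 ?sumr_ge0//.
  - by rewrite andbT; apply/hasP; exists i;
    rewrite ?mem_index_enum//= -expr2 lt_def sqrf_eq0 bi0 sqr_ge0.
  - by move=> j _; rewrite -expr2 sqr_ge0.
  - by move=> j _; rewrite -expr2 sqr_ge0.
case: (IHm g b) => [[l l0 bE]|[x0 gx0 bx0]].
  left; exists (fun j => if j == m then 0 else l j) => [j|i].
    by case: ifP.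
  rewrite big_ord_recr/= eqxx mul0r addr0 bE; apply: eq_bigr => j _.
  by rewrite ltn_eqF.
set dot := fun u x : I -> R => \sum_i u i * x i.
have dotE u x : \sum_i u i * x i = dot u x by [].
have dotB u v a x : dot (fun i => u i - a * v i) x = dot u x - a * dot v x.
  rewrite /dot mulr_sumr -sumrB; apply: eq_bigr => i _; ring.
have dotBr u a x y : dot u (fun i => x i - a * y i) = dot u x - a * dot u y.
  rewrite /dot mulr_sumr -sumrB; apply: eq_bigr => i _; ring.
case: (lerP (dot (g m) x0) 0) => [gm|gm].
  right; exists x0 => // j; rewrite ltnS leq_eqVlt => /orP[/eqP->//|]; exact: gx0.
have gmN : dot (g m) x0 != 0 by rewrite gt_eqF.
(* Coefficients of the projection. As [p j <= 0 < q] for [j < m], lifting a conic combination gives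
   [g m] a nonnegative coefficient. *)
pose p j := dot (g j) x0 / dot (g m) x0.
pose q := dot b x0 / dot (g m) x0.
case: (IHm (fun j i => g j i - p j * g m i) (fun i => b i - q * g m i)) => [[l l0
  bE]|[x gx bx]].
  left; exists (fun j => if j == m then q - \sum_(k < m) l k * p k else l j) => [j|i].
    case: ifP => // _; rewrite subr_ge0 (@le_trans _ _ 0)//.
      apply: sumr_le0 => k _; rewrite mulr_ge0_le0// /p pmulr_lle0 ?invr_gt0//;
        exact: gx0.
    by rewrite /q divr_ge0// ltW.
  rewrite big_ord_recr/= eqxx (eq_bigr (fun k : 'I_m => l k * g k i)); last first.
    by move=> k _; rewrite ltn_eqF.
  have /eqP := bE i; rewrite subr_eq => /eqP ->.
  rewrite mulrBl mulr_suml (eq_bigr (fun k : 'I_m => l k * g k i - l k * p k * g m i)).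
    by rewrite sumrB; ring.
  by move=> k _; ring.
right; exists (fun i => x i - (dot (g m) x / dot (g m) x0) * x0 i) => [j|].
  rewrite dotE dotBr ltnS leq_eqVlt => /orP[/eqP->|jm].
    by rewrite divfK// subrr.
  have := gx j jm; rewrite dotE dotB /p.
  by congr (_ <= _); field.
move: bx; rewrite !dotE dotB dotBr /q.
by congr (_ < _); field.
Qed.

(** Farkas' lemma for the target [(b, S)]: a conic combination is a packing, and a separating vector
    divided by its last coordinate is, up to sign, a cover. *)
Lemma packing_covering_duality (C T : finType) (A : T -> C -> R) (b : C -> R)
    (S : R) :
  (forall c, 0 <= b c) ->
  (exists x : T -> R, [/\ forall t, 0 <= x t,
     forall c, \sum_t x t * A t c <= b c & S <= \sum_t x t]) \/
  (exists y : C -> R, [/\ forall c, 0 <= y c,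
     forall t, 1 <= \sum_c A t c * y c & \sum_c b c * y c < S]).
Proof.
move=> b0.
(* Generators: the columns [(A t, 1)], the slacks [(e_c, 0)] and [(0, -1)];
   the target is [(b, S)], the last coordinate being [None]. *)
pose G := (T + option C)%type.
pose col (u : G) (i : option C) : R :=
  match u, i with
  | inl t, Some c => A t c
  | inl t, None => 1
  | inr (Some c'), Some c => (c == c')%:R
  | inr (Some c'), None => 0
  | inr None, Some c => 0
  | inr None, None => -1
  end.
pose tgt (i : option C) : R := if i is Some c then b c else S.
pose g (j : nat) : option C -> R :=
  if insub j is Some k then col (enum_val (k : 'I_#|{: G}|)) else fun=> 0.
have gE (k : 'I_#|{: G}|) : g k = col (enum_val k).
  by rewrite /g insubT// => lt; congr (col (enum_val _)); apply: val_inj.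
have sumoC (F : option C -> R) : \sum_i F i = F None + \sum_c F (Some c).
  rewrite (bigD1 None)//=; congr (_ + _).
  rewrite (reindex_omap Some id) => [|[]//]; apply: eq_bigl => c.
  by rewrite eqxx.
case: (farkas #|{: G}| g tgt) => [[l l0 tE]|[x gx bx]].
  left.
  pose lu (u : G) := l (enum_rank u).
  have {}tE i : tgt i = \sum_t lu (inl t) * col (inl t) i +
      \sum_(o : option C) lu (inr o) * col (inr o) i.
    rewrite tE (eq_bigr (fun k : 'I_#|{: G}| => lu (enum_val k) * col (enum_val k) i));
      last first.
      by move=> k _; rewrite gE /lu enum_valK.
    rewrite -(big_enum_val (fun u => lu u * col u i))/=.
    by rewrite big_sumType.
  exists (fun t => lu (inl t)); split => [t|c|]; first exact: l0.
    have := tE (Some c); rewrite /= => ->; rewrite lerDl sumoC/= mulr0 add0r.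
    by rewrite sumr_ge0// => c' _; rewrite mulr_ge0 ?l0 ?ler0n.
  have := tE None; rewrite /= => ->; rewrite sumoC/= [X in _ + (_ + X)]big1 => [|c _];
    last by rewrite mulr0.
  rewrite (eq_bigr (fun t => lu (inl t))) => [|t _]; last by rewrite mulr1.
  by rewrite addr0 mulrN1 gerDl oppr_le0; apply: l0.
right.
have {}gx (u : G) : \sum_i col u i * x i <= 0.
  by have := gx (enum_rank u) (ltn_ord _); rewrite gE enum_rankK.
have x0 c : x (Some c) <= 0.
  have := gx (inr (Some c)); rewrite sumoC/= mul0r add0r (bigD1 c)//= eqxx mul1r.
  by rewrite big1 ?addr0// => c' /negPf ->; rewrite mul0r.
have z0 : 0 <= x None.
  have := gx (inr None); rewrite sumoC/= mulN1r big1 ?addr0 ?oppr_le0// => c' _.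
  by rewrite mul0r.
move: bx; rewrite sumoC/= => bx.
(* A separator with last coordinate 0 would pair nonpositively with the target, because [b] is
   nonnegative. *)
have z1 : 0 < x None.
  rewrite lt_neqAle z0 andbT eq_sym; apply/eqP => z; move: bx; rewrite z mulr0 add0r.
  by apply/negP; rewrite -leNgt sumr_le0// => c _; rewrite mulr_ge0_le0.
exists (fun c => - x (Some c) / x None); split => [c|t|].
- by rewrite divr_ge0 ?oppr_ge0.
- have := gx (inl t); rewrite sumoC/= mul1r => h.
  rewrite (eq_bigr (fun c => - (A t c * x (Some c)) / x None)) => [|c _];
    last by rewrite mulrA mulrN.
  by rewrite -mulr_suml sumrN ler_pdivlMr// mul1r; lra.
- rewrite (eq_bigr (fun c => - (b c * x (Some c)) / x None)) => [|c _];
  last by rewrite mulrA mulrN.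
  by rewrite -mulr_suml sumrN ltr_pdivrMr//; lra.
Qed.

(** While the support has more than [#|C|] elements, the rows of [A] on it are dependent; moving
    along a dependence keeps all loads, and the move stops when an entry of the support vanishes. *)
Lemma packing_basic_solution (C T : finType) (A : T -> C -> R) (x : T -> R) :
  (forall t c, 0 <= A t c) -> (forall t, exists c, 0 < A t c) ->
  (forall t, 0 <= x t) ->
  exists x' : T -> R, [/\ forall t, 0 <= x' t,
    forall c, \sum_t x' t * A t c = \sum_t x t * A t c,
    \sum_t x t <= \sum_t x' t & (#|[set t | x' t != 0%R]| <= #|C|)%N].
Proof.
move=> A0 A1.
have [n] := ubnP #|[set t | x t != 0]|; elim: n x => // n IHn x; rewrite ltnS => le_n x0.
case: (leqP #|[set t | x t != 0]| #|C|) => [leC|ltC]; first by exists x; split.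
set D := [set t | x t != 0] in le_n ltC *.
pose M : 'M[R]_(#|D|, #|C|) := \matrix_(i, j) A (enum_val i) (enum_val j).
have /rowV0Pn[v /sub_kermxP vM vN0] : kermx M != 0.
  by rewrite -mxrank_eq0 mxrank_ker -lt0n subn_gt0 (leq_ltn_trans (rank_leq_col _)).
have [z [zD zN0 zA]] : exists z : T -> R, [/\ forall t, t \notin D -> z t = 0,
    exists t, z t != 0 & forall c, \sum_t z t * A t c = 0].
  pose z t := \sum_(k < #|D|) v 0 k * (enum_val k == t)%:R.
  have zE (k : 'I_#|D|) : z (enum_val k) = v 0 k.
    rewrite /z (bigD1 k)//= eqxx mulr1 big1 ?addr0// => k' /negPf kk'.
    by rewrite (inj_eq enum_val_inj) kk' mulr0.
  have zD t : t \notin D -> z t = 0.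
    move=> tD; rewrite /z big1// => k _; case: eqP => [kt|]; rewrite ?mulr0//.
    by move: tD; rewrite -kt enum_valP.
  exists z; split=> //.
    have /rV0Pn[k vk] := vN0; by exists (enum_val k); rewrite zE.
  move=> c; have := congr1 (fun w : 'rV_ _ => w 0 (enum_rank c)) vM.
  rewrite !mxE (eq_bigr (fun k : 'I_#|D| => z (enum_val k) * A (enum_val k) c));
    last first.
    by move=> k _; rewrite mxE enum_rankK zE.
  rewrite -(big_enum_val (fun t => z t * A t c)) => {2}<-.
  rewrite [RHS]big_mkcond/=; apply: eq_bigr => t _.
  by case: ifPn => // /zD ->; rewrite mul0r.
(* The sign of [z] is chosen so that its sum is nonnegative. A negative entry exists, since a
   nonzero nonnegative [z] would load some [c] positively. *)
have {z zD zN0 zA} [z [zD [t0 zt0] zA zS]] : exists z : T -> R, [/\ forall t, t \notin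
  D -> z t = 0,
    exists t, z t < 0, forall c, \sum_t z t * A t c = 0 & 0 <= \sum_t z t].
  have neg (u : T -> R) : (exists t, u t != 0) ->
      (forall c, \sum_t u t * A t c = 0) -> exists t, u t < 0.
    move=> [t ut] uA; case: (boolP [exists t, u t < 0]) => [/existsP//|/existsPn un].
    have un' t' : 0 <= u t' by rewrite leNgt un.
    have [c Atc] := A1 t; move: (uA c) => /eqP.
    rewrite psumr_eq0 => [/allP/(_ t)|t' _]; last by rewrite mulr_ge0.
    by rewrite mem_index_enum mulf_eq0 (negPf ut) (gt_eqF Atc) => /(_ isT).
  case: (lerP 0 (\sum_t z t)) => zs; first by exists z; split=> //; apply: neg.
  exists (fun t => - z t); split=> [t tD|||].
  - by rewrite zD ?oppr0.
  - apply: neg => [|c]; first by case: zN0 => t zt; exists t; rewrite oppr_eq0.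
    by under eq_bigr do rewrite mulNr; rewrite sumrN zA oppr0.
  - by move=> c; under eq_bigr do rewrite mulNr; rewrite sumrN zA oppr0.
  - by rewrite sumrN oppr_ge0 ltW.
(* The least ratio over the negative entries of [z] is the longest step that keeps [x] nonnegative,
   and it empties [t1]. *)
pose ratio t := x t / - z t.
have [t1 zt1 t1min] := @arg_minP _ _ _ t0 (fun t => z t < 0) ratio zt0.
have l0 : 0 <= ratio t1 by rewrite divr_ge0// oppr_ge0 ltW.
pose x1 t := x t + ratio t1 * z t.
have x10 t : 0 <= x1 t.
  rewrite /x1; case: (lerP 0 (z t)) => zt; first by rewrite addr_ge0// mulr_ge0.
  have := t1min t zt; rewrite {2}/ratio ler_pdivlMr ?oppr_gt0// mulrN => h.
  by rewrite -(opprK (_ * z t)) subr_ge0.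
have x1t1 : x1 t1 = 0 by rewrite /x1 /ratio invrN mulrN mulNr divfK ?subrr ?lt_eqF.
have t1D : t1 \in D by apply: contraTT zt1 => /zD ->; rewrite ltxx.
have sub : [set t | x1 t != 0] \subset D :\ t1.
  apply/subsetP => t; rewrite !inE => h; apply/andP; split.
    by apply: contraNneq h => ->; rewrite x1t1.
  apply: contraNneq h => xt; rewrite /x1 xt add0r zD ?mulr0//.
  by rewrite inE xt eqxx.
case: (IHn x1) => //.
  apply: leq_trans (leq_ltn_trans (subset_leq_card sub) _) le_n.
  by rewrite [ltnRHS](cardsD1 t1) t1D.
move=> x' [x'0 x'A x'S x'C]; exists x'; split=> //.
  move=> c; rewrite x'A /x1; under eq_bigr do rewrite mulrDl -mulrA.
  by rewrite big_split/= -mulr_sumr zA mulr0 addr0.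
apply: le_trans x'S; rewrite /x1 big_split/= -mulr_sumr lerDl.
by rewrite mulr_ge0.
Qed.

End LinearProgramming.

(** * Frankl's bound for threshold families *)

Section SymmetricAveraging.
Variable V : finType.
Implicit Types (A B H Y : {set V}).

Lemma subset_of_card A k : k <= #|A| -> exists2 B : {set V}, B \subset A & #|B| = k.
Proof.
move=> le_k; have : 0 < #|[set B : {set V} | (B \subset A) && (#|B| == k)]|.
  by rewrite cards_draws bin_gt0.
by case/card_gt0P => B; rewrite inE => /andP[BA /eqP Bk]; exists B.
Qed.

(** Induction on [#|B :\: H|]: a transposition of a point of [B :\: H] with one of [H :\: B] brings
    [B] closer to [H]. *)
Lemma Sym_transitive Y B H : B \subset Y -> H \subset Y -> #|B| = #|H| ->
  exists2 t : {perm V}, t \in Sym Y & t @: B = H.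
Proof.
have [n] := ubnP #|B :\: H|; elim: n B => // n IHn B; rewrite ltnS => le_n BY HY BH.
case: (set_0Vmem (B :\: H)) => [BH0|[x]].
  exists 1%g; first exact: group1.
  rewrite (eq_imset (g := id)) => [|x]; last by rewrite perm1.
  rewrite imset_id; apply/eqP; rewrite eqEcard BH leqnn andbT.
  by rewrite -setD_eq0 BH0.
rewrite inE => /andP[xH xB].
have : 0 < #|H :\: B|.
  rewrite cardsD -BH setIC -cardsD; apply/card_gt0P; exists x.
  by rewrite inE xH.
case/card_gt0P => y; rewrite inE => /andP[yB yH].
have xy : x != y by apply: contraNneq yB => <-.
pose t0 := tperm x y.
have t0Y : t0 \in Sym Y.
  rewrite inE; apply/subsetP => z; rewrite inE.
  by case: tpermP => [-> _|-> _|_ _]; rewrite ?eqxx//;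
    [exact: (subsetP BY)|exact: (subsetP HY)].
have t0B : t0 @: B = y |: (B :\ x).
  apply/setP => z; rewrite -[in LHS](tpermK x y z) mem_imset; last exact: perm_inj.
  rewrite !inE; case: tpermP => [->|->|/eqP zx /eqP zy].
  - by rewrite (negPf yB) eqxx (negPf xy).
  - by rewrite xB eqxx.
  - by rewrite (negPf zx) (negPf zy).
case: (IHn (t0 @: B)) => //.
- apply: leq_trans le_n; rewrite t0B (cardsD1 x (B :\: H)) inE xH xB ltnS.
  apply: subset_leq_card; apply/subsetP => z; rewrite !inE => /andP[zH].
  by case/predU1P => [zy|/andP[-> ->]]; rewrite ?zH//; move: zH; rewrite zy yH.
- rewrite t0B; apply/subsetP => z /setU1P[->|]; first exact: (subsetP HY).
  by move/setD1P => [_ /(subsetP BY)].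
- by rewrite card_imset//; exact: perm_inj.
move=> t tY tB; exists (t0 * t)%g; first by rewrite groupM.
rewrite -tB -imset_comp; apply: eq_imset => z.
by rewrite /= permM.
Qed.

(** Right multiplication by a permutation taking [H] to [H'] maps one fibre injectively into the
    other. *)
Lemma card_Sym_fiber Y B H H' : H \subset Y -> H' \subset Y -> #|H| = #|H'| ->
  #|[set s in Sym Y | s @: B == H]| = #|[set s in Sym Y | s @: B == H']|.
Proof.
suff le H1 H2 : H1 \subset Y -> H2 \subset Y -> #|H1| = #|H2| ->
    #|[set s in Sym Y | s @: B == H1]| <= #|[set s in Sym Y | s @: B == H2]|.
  by move=> HY HY' e; apply/eqP; rewrite eqn_leq !le.
move=> HY HY' e; have [t tY tH] := Sym_transitive HY HY' e.
rewrite -(card_imset _ (mulIg t)); apply: subset_leq_card.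
apply/subsetP => _ /imsetP[s + ->]; rewrite !inE => /andP[sY /eqP sB].
move: (groupM (x := s) (y := t) (G := Sym_group Y)); rewrite !inE => -> //=;
  last by move: tY; rewrite inE.
rewrite -tH -sB -imset_comp; apply/eqP; apply: eq_imset => z.
by rewrite /= permM.
Qed.

Lemma disjoint_blocks (J : finType) Y k : #|J| * k <= #|Y| ->
  exists B : J -> {set V}, [/\ forall j, B j \subset Y, forall j, #|B j| = k &
    forall i j, i != j -> [disjoint B i & B j]].
Proof.
move=> JkY.
have idx (j : J) (i : 'I_k) : enum_rank j * k + i < #|Y|.
  apply: leq_trans JkY; apply: (@leq_trans ((enum_rank j).+1 * k)).
    by rewrite mulSn addnC ltn_add2r.
  by rewrite leq_mul2r ltn_ord orbT.
pose f j i := enum_val (Ordinal (idx j i)).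
have f_inj j i j' i' : f j i = f j' i' -> j = j' /\ i = i'.
  move/enum_val_inj => /(congr1 val)/= e.
  have k0 : 0 < k by apply: leq_ltn_trans (ltn_ord i).
  have ejj : enum_rank j = enum_rank j' :> nat.
    by have := congr1 (fun x => x %/ k) e; rewrite !divnMDl// !divn_small// !addn0.
  split; first by apply: enum_rank_inj; apply: val_inj.
  by apply: val_inj; move: e; rewrite ejj => /addnI.
exists (fun j => [set f j i | i : 'I_k]); split=> [j|j|j j' jj'].
- by apply/subsetP => _ /imsetP[i _ ->]; apply: enum_valP.
- by rewrite card_imset ?card_ord// => i i' /f_inj[].
- rewrite -setI_eq0; apply/eqP/setP => x; rewrite !inE.
  apply/negP => /andP[/imsetP[i _ ->] /imsetP[i' _ /f_inj[e _]]].
  by rewrite e eqxx in jj'.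
Qed.

(* Move fixed disjoint blocks by a uniformly random permutation of [Y]: each
   block becomes a uniformly random [k]-subset. *)
Lemma sum_card_matching (J : finType) Y k s (F : J -> {set {set V}}) :
  #|J| * k <= #|Y| ->
  (forall j H, H \in F j -> H \subset Y /\ #|H| = k) ->
  (forall B : J -> {set V}, (forall j, B j \subset Y) ->
     (forall i j, i != j -> [disjoint B i & B j]) ->
     #|[set j | B j \in F j]| <= s) ->
  \sum_j #|F j| <= s * 'C(#|Y|, k).
Proof.
move=> JkY FY sB; have [B [BY Bk Bdisj]] := disjoint_blocks JkY.
have SymB (p : {perm V}) j : p \in Sym Y -> p @: B j \subset Y.
  move=> pY; apply/subsetP => _ /imsetP[x xB ->].
  move: pY; rewrite inE => pY; rewrite perm_closed//.
  exact: (subsetP (BY j)).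
pose S := Sym Y.
have fiber j H : H \subset Y -> #|H| = k ->
    #|[set p in S | p @: B j == H]| * 'C(#|Y|, k) = #|S|.
  move=> HY Hk.
  rewrite -[RHS]sum1_card (partition_big (fun p : {perm V} => p @: B j)
    [pred H' : {set V} | (H' \subset Y) && (#|H'| == k)]) /=; last first.
    by move=> p pS; rewrite SymB// card_imset ?Bk ?eqxx//; apply: perm_inj.
  rewrite (eq_bigr (fun=> #|[set p in S | p @: B j == H]|)).
    by rewrite sum_nat_const -cards_draws mulnC cardsE.
  move=> H' /andP[H'Y /eqP H'k]; rewrite sum1dep_card.
  by apply: card_Sym_fiber; rewrite ?Hk.
have [C0|C_gt0] := posnP 'C(#|Y|, k).
  rewrite big1 ?C0 ?muln0// => j _; apply/eqP; rewrite cards_eq0 -subset0.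
  apply/subsetP => H /FY[HY Hk]; move/eqP: C0.
  by rewrite -cards_draws cards_eq0 => /eqP/setP/(_ H); rewrite !inE HY Hk eqxx.
have S_gt0 : 0 < #|S| by rewrite card_Sym fact_gt0.
rewrite -(leq_pmul2r S_gt0) big_distrl/=.
have FE j : #|F j| * #|S| = \sum_(p in S) (p @: B j \in F j) * 'C(#|Y|, k).
  rewrite -big_distrl/= -sum_nat_const.
  rewrite (eq_bigr (fun H => #|[set p in S | p @: B j == H]| * 'C(#|Y|, k))); last first.
    by move=> H /FY[HY Hk]; rewrite fiber.
  rewrite -big_distrl/=; congr (_ * _).
  under eq_bigr do rewrite -sum1_card.
  rewrite (exchange_big_dep (mem S))/=; last by move=> H p _; rewrite inE => /andP[].
  apply: eq_bigr => p pS; rewrite sum1dep_card.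
  have pY : perm_on Y p by rewrite inE in pS.
  case: (boolP (_ \in F j)) => [pF|pF].
    transitivity #|[set p @: B j]|; last by rewrite cards1.
    apply: eq_card => H.
    by rewrite !inE pY/= eq_sym; case: eqP => [->|]; rewrite ?pF ?andbF.
  apply/eqP; rewrite cards_eq0; apply/eqP/setP => H; rewrite !inE pY/=.
  by apply/negP => /andP[HF /eqP e]; rewrite e HF in pF.
rewrite (eq_bigr _ (fun j _ => FE j)) exchange_big/= mulnC -sum_nat_const.
apply: leq_sum => p pS; rewrite -big_distrl/= leq_mul2r; apply/orP; right.
apply: leq_trans (sB (fun j => p @: B j) _ _).
- by rewrite -sum1dep_card [leqRHS]big_mkcond/=; apply: leq_sum => j _; case: ifP.
- by move=> j; apply: SymB.
- move=> i j ij; rewrite imset_disjoint ?Bdisj//; exact: perm_inj.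
Qed.

End SymmetricAveraging.

(** * Shadows and extensions of threshold families *)

Section ThresholdFamilies.
Variables (R : realFieldType) (V : finType) (w : V -> R).
Implicit Types (A D H Y e : {set V}).
Local Open Scope ring_scope.

Definition weight D : R := \sum_(v in D) w v.

Definition heavy Y k (theta : R) : {set {set V}} :=
  [set e : {set V} | [&& e \subset Y, #|e| == k & theta <= weight e]].

Lemma weight_setU1 v D : v \notin D -> weight (v |: D) = w v + weight D.
Proof. by move=> vD; rewrite /weight big_setU1. Qed.

Lemma weight_setU D1 D2 : [disjoint D1 & D2] ->
  weight (D1 :|: D2) = weight D1 + weight D2.
Proof. by move=> D12; rewrite /weight -bigU//; apply: eq_bigl => x; rewrite !inE. Qed.

Lemma card_heavy_split Y k theta y : y \in Y ->
  #|heavy Y k.+1 theta| =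
  (#|heavy (Y :\ y) k.+1 theta| + #|heavy (Y :\ y) k (theta - w y)|)%N.
Proof.
move=> yY; rewrite -(cardsID [set e : {set V} | y \in e] (heavy Y k.+1 theta)) addnC.
congr (_ + _)%N.
  apply: eq_card => e; rewrite !inE subsetD1.
  by case: (y \in e); rewrite ?andbF ?andbT//=.
rewrite -(card_in_imset (f := fun e => y |: e) (D := heavy (Y :\ y) k _)).
  apply: eq_card => e; rewrite !inE; apply/idP/imsetP.
    move=> /andP[/and3P[eY /eqP ek th] ye]; exists (e :\ y); last by rewrite setD1K.
    rewrite inE setSD//=; move: ek; rewrite (cardsD1 y) ye => /succn_inj ->;
      rewrite eqxx/=.
    by move: th; rewrite -[in weight e](setD1K ye) weight_setU1 ?setD11//; lra.
  move=> [d + ->]; rewrite inE subsetD1 => /and3P[/andP[dY yd] /eqP dk th].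
  rewrite subUset sub1set yY dY cardsU1 yd dk eqxx setU11/= andbT.
  by rewrite weight_setU1//; move: th; lra.
move=> d d'; rewrite !inE !subsetD1 => /andP[/andP[_ yd] _] /andP[/andP[_ yd'] _] e.
by rewrite -(setU1K yd) e setU1K.
Qed.

(* The last hypothesis says that the [s.+1 * r] heaviest elements of [Y] do not
   contain [s.+1] disjoint heavy [r]-sets; unlike [weight Y < s.+1 * theta], it is
   inherited when the lightest element of [Y] is removed or is put in the edge. *)
Lemma card_heavy_shadow (Y : {set V}) r s (theta u : R) :
  (0 < r)%N -> (forall y, y \in Y -> w y <= u) ->
  (forall D, D \subset Y -> (#|D| <= s.+1 * r)%N -> weight D < s.+1%:R * theta) ->
  (#|heavy Y r theta| <= s * #|heavy Y r.-1 (theta - u)|)%N.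
Proof.
have [n] := ubnP #|Y|; elim: n Y r theta => // n IHn Y r theta; rewrite ltnS => le_n.
case: r => // -[|r] _ hu hD.
  (* Edges are single points here. One heavy point already puts the empty set in the shadow, and
     [s.+1] of them would form a set [D] violating the hypothesis. *)
  have [->|[e0 e0h]] := set_0Vmem (heavy Y 1 theta); first by rewrite cards0.
  rewrite -[leqLHS]muln1 leq_mul//; last first.
    apply/card_gt0P; exists set0; rewrite inE sub0set cards0 eqxx/=.
    move: e0h; rewrite inE => /and3P[+ /cards1P[y e0y]].
    by rewrite e0y sub1set /weight big_set1 big_set0 => /hu; lra.
  rewrite leqNgt; apply/negP => s_lt.
  pose P := [set y in Y | theta <= w y].
  have : (s < #|P|)%N.
    apply: leq_trans s_lt _; rewrite -(card_imset P set1_inj).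
    apply: subset_leq_card; apply/subsetP => e; rewrite inE => /and3P[eY /cards1P[y ey]].
    move: eY; rewrite ey sub1set /weight big_set1 => yY yt; apply: imset_f.
    by rewrite inE yY.
  case/subset_of_card => D /subsetP DP Ds.
  have := hD D; rewrite muln1 Ds leqnn.
  have -> : D \subset Y by apply/subsetP => y /DP; rewrite inE => /andP[].
  move=> /(_ isT isT); apply/negP; rewrite -leNgt -Ds mulr_natl -sumr_const.
  by apply: ler_sum => y /DP; rewrite inE => /andP[].
(* For small [Y], pairs of an edge and a shadow element inside it are counted in two ways: an edge
   has [r.+2] of them, and a shadow element extends by at most [#|Y| - r.+1 <= s * r.+2] points. *)
case: (ltnP #|Y| (s.+1 * r.+2)) => [Ys|Ys].
  pose F := heavy Y r.+2 theta; pose G := heavy Y r.+1 (theta - u).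
  rewrite -/F -/G -(@leq_pmul2l r.+2)// mulnC.
  apply: (@leq_trans (\sum_(e in F) #|[set H in G | H \subset e]|)).
    rewrite -sum_nat_const; apply: leq_sum => e; rewrite inE => /and3P[eY /eqP er th].
    rewrite -er -(card_in_imset (f := fun x => e :\ x) (D := e)).
      apply: subset_leq_card; apply/subsetP => _ /imsetP[x xe ->].
      rewrite !inE subD1set andbT (subset_trans (subD1set _ _) eY)/=.
      move: er; rewrite (cardsD1 x) xe => /succn_inj ->; rewrite eqxx/=.
      move: th; rewrite -[in weight e](setD1K xe) weight_setU1 ?setD11//.
      by have := hu x (subsetP eY x xe); lra.
    move=> x x' xe x'e /setP/(_ x); rewrite !inE eqxx xe/= andbT.
    by move=> h; apply/eqP/negbFE; rewrite -h.
  under eq_bigr do rewrite -sum1_card.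
  rewrite (exchange_big_dep (mem G))/=; last by move=> e H _; rewrite inE => /andP[].
  rewrite mulnA [(r.+2 * s)%N]mulnC mulnC -sum_nat_const; apply: leq_sum => H HG.
  have /and3P[HY /eqP Hr _] : [&& H \subset Y, #|H| == r.+1 & theta - u <= weight H].
    by rewrite inE in HG.
  have YH : (#|Y :\: H| <= s * r.+2)%N.
    by rewrite cardsD (setIidPr HY) Hr; move: Ys; rewrite mulSn; lia.
  rewrite sum1dep_card; apply: leq_trans YH.
  apply: leq_trans (leq_imset_card (fun x => x |: H) (mem (Y :\: H))).
  apply: subset_leq_card; apply/subsetP => e; rewrite !inE.
  move=> /andP[/and3P[eY /eqP er _] /andP[_ He]].
  have /card_gt0P[x] : (0 < #|e :\: H|)%N.
    by rewrite cardsD (setIidPr He) er Hr subSnn.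
  rewrite inE => /andP[xH xe]; apply/imsetP; exists x.
    by rewrite inE xH (subsetP eY).
  apply/eqP; rewrite eq_sym eqEcard subUset sub1set xe He/=.
  by rewrite cardsU1 xH Hr er.
(* For large [Y], the lightest [y] is removed; the edges avoiding [y] and those through [y] are
   bounded separately by induction. *)
have /card_gt0P[y0 y0Y] : (0 < #|Y|)%N by apply: leq_trans Ys.
have [y yY ymin] := @arg_minP _ _ _ y0 (fun y => y \in Y) w y0Y.
have le_n' : (#|Y :\ y| < n)%N by move: le_n; rewrite (cardsD1 y) yY.
have hu' z : z \in Y :\ y -> w z <= u by move=> /setD1P[_ /hu].
rewrite (card_heavy_split _ _ yY) (@card_heavy_split Y r _ y yY) mulnDr.
apply: leq_add.
  apply: IHn => // D DY; apply: hD; apply: subset_trans DY (subD1set _ _).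
rewrite (_ : theta - u - w y = theta - w y - u); last by lra.
apply: (IHn _ r.+1) => // D DY Ds.
have DY' : D \subset Y by apply: subset_trans DY (subD1set _ _).
(* Enlarging [D] by [s.+1] points, each at least as heavy as [y], derives the hypothesis for the
   threshold [theta - w y] from the one for [theta]. *)
have : (s.+1 <= #|Y :\: D|)%N.
  by rewrite cardsD (setIidPr DY'); move: Ys Ds; lia.
case/subset_of_card => D' D'Y D's.
have DD' : [disjoint D & D'].
  rewrite disjoint_sym; apply: disjointWl D'Y _.
  by rewrite disjoint_subset; apply/subsetP => z; rewrite !inE => /andP[].
have : weight (D :|: D') < s.+1%:R * theta.
  apply: hD; first by rewrite subUset DY' (subset_trans D'Y (subsetDl _ _)).
  by rewrite cardsU D's; move: Ds; lia.
rewrite weight_setU// mulrBr ltrBrDr; apply: le_lt_trans; rewrite lerD2l.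
rewrite -D's mulr_natl -sumr_const; apply: ler_sum => z zD'; apply: ymin.
by apply: (subsetP (subset_trans D'Y (subsetDl _ _))).
Qed.

Lemma card_heavy_compl Y k theta :
  (#|heavy Y k theta| + #|[set e : {set V} | [&& e \subset Y, #|e| == k & (weight e <
    theta)%R]]|
     = 'C(#|Y|, k))%N.
Proof.
rewrite -cards_draws -[RHS](cardsID [set e : {set V} | (theta <= weight e)%R]);
  congr (_ + _)%N.
  by apply: eq_card => e; rewrite !inE -andbA.
by apply: eq_card => e; rewrite !inE -ltNge [RHS]andbC -andbA.
Qed.

(** Complementary counting: the light [k]-sets inside [Y] are light [k]-sets inside [Z]. *)
Lemma card_heavy_sub Y (Z : {set V}) k theta : Y \subset Z ->
  (#|heavy Z k theta| + 'C(#|Y|, k) <= 'C(#|Z|, k) + #|heavy Y k theta|)%N.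
Proof.
move=> YZ; rewrite -(card_heavy_compl Y k theta) -(card_heavy_compl Z k theta).
rewrite addnA addnAC leq_add2r leq_add2l; apply: subset_leq_card.
apply/subsetP => e; rewrite !inE => /and3P[eY -> ->].
by rewrite (subset_trans eY YZ).
Qed.

(** Sets meeting [s] at most once are counted exactly, and every set meeting it at least twice is
    allowed to be heavy. The points of [s] are added one at a time. *)
Lemma card_heavy_extend Y k theta (s : seq V) :
  uniq s -> [disjoint Y & s] ->
  (#|heavy (Y :|: [set x in s]) k.+1 theta| + size s * 'C(#|Y|, k) + 'C(#|Y|, k.+1)
   <= #|heavy Y k.+1 theta| + \sum_(a <- s) #|heavy Y k (theta - w a)|
      + 'C(#|Y| + size s, k.+1))%N.
Proof.
elim: s => [_ _|a s IHs /= /andP[aNs us]].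
  by rewrite big_nil (_ : [set x in [::]] = set0) ?setU0 ?addn0 ?mul0n ?addn0//;
    apply/setP => x; rewrite !inE.
rewrite disjoint_sym disjoint_cons disjoint_sym => /andP[aNY Ys].
set Z := Y :|: [set x in s].
have aNZ : a \notin Z by rewrite !inE negb_or aNY.
have -> : Y :|: [set x in a :: s] = a |: Z.
  by apply/setP => x; rewrite !inE orbCA.
rewrite (card_heavy_split _ _ (setU11 a Z)) setU1K// big_cons.
have {IHs} := IHs us Ys; rewrite -/Z.
have := @card_heavy_sub Y Z k (theta - w a) (subsetUl _ _).
have -> : #|Z| = (#|Y| + size s)%N.
  rewrite cardsU (_ : Y :&: _ = set0) ?cards0 ?subn0.
    by congr (_ + _)%N; rewrite cardsE; apply/card_uniqP.
  apply/eqP; rewrite setI_eq0; apply: disjointWr Ys.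
  by apply/subsetP => x; rewrite inE.
rewrite addnS binS mulSn.
move: #|heavy Z k.+1 _| #|heavy Z k _| #|heavy Y k.+1 _| #|heavy Y k (theta - w a)|.
move: (\sum_(_ <- _) _)%N.
move: 'C(#|Y| + _, k) 'C(#|Y| + _, k.+1) 'C(#|Y|, k) (size s * _)%N => *; lia.
Qed.

End ThresholdFamilies.

(** * The matching bound for threshold families *)

Section ThresholdBound.
Variables (R : realFieldType) (V : finType) (w : V -> R).
Hypothesis w_ge0 : forall v, (0 <= w v)%R.
Implicit Types (A D H Y e : {set V}).
Local Open Scope ring_scope.

(** In an [s.+1]-set of maximal weight, exchanging the lightest point for an outside point cannot
    increase the weight. *)
Lemma exists_heaviest_set s : (s < #|V|)%N -> exists A : {set V}, exists2 a0,
  #|A| = s.+1 & [/\ a0 \in A, forall a, a \in A -> w a0 <= w a &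
    forall y, y \notin A -> w y <= w a0].
Proof.
rewrite -cardsT => /subset_of_card[A0 _ A0s].
have [A /eqP As Amax] := @arg_maxP _ _ _ A0 (fun A => #|A| == s.+1) (weight w) (introT
  eqP A0s).
have /card_gt0P[a1 a1A] : (0 < #|A|)%N by rewrite As.
have [a0 a0A amin] := @arg_minP _ _ _ a1 (fun a => a \in A) w a1A.
exists A; exists a0 => //; split=> // y yA.
have yA0 : y \notin A :\ a0 by rewrite !inE negb_and yA orbT.
have := Amax (y |: (A :\ a0)); rewrite cardsU1 yA0.
rewrite /= weight_setU1// -{3}(setD1K a0A) weight_setU1 ?setD11//.
by move: As; rewrite (cardsD1 a0) a0A => /succn_inj ->; rewrite eqxx => /(_ isT); lra.
Qed.

Lemma sum_weight_disjoint (J : finType) (P : {set J}) (B : J -> {set V}) Y :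
  (forall j, B j \subset Y) -> (forall i j, i != j -> [disjoint B i & B j]) ->
  \sum_(j in P) weight w (B j) <= weight w Y.
Proof.
move=> BY Bd; rewrite /weight (exchange_big_dep (mem Y))/=; last first.
  by move=> j v _; apply: subsetP.
apply: ler_sum => v vY;
  case: (pickP (fun j => (j \in P) && (v \in B j))) => [j0 j0P|none].
  rewrite (bigD1 j0)//= big1 ?addr0// => j /andP[/andP[_ vj] jj0].
  have := Bd _ _ jj0; rewrite -setI_eq0 => /eqP/setP/(_ v); rewrite !inE vj.
  by case/andP: j0P => _ ->.
by rewrite big_pred0.
Qed.

(** Frankl's argument. Let [A] be the [s.+1] heaviest vertices and [Y] the rest. Heavy sets inside
    [Y] are bounded by [s] copies of a shadow, those meeting [A] once are counted by their traces on
    [Y], and all other sets are allowed. Averaging bounds the [s + s.+1] families on [Y] together by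
    [s * 'C(#|Y|, k)]. *)
Lemma card_heavy_bound s r : (0 < r)%N ->
  ((s.*2.+1 * r.-1 + s.+1 <= #|V|)%N) -> weight w [set: V] < s.+1%:R ->
  (#|heavy w [set: V] r 1| + 'C(#|V| - s, r) <= 'C(#|V|, r))%N.
Proof.
case: r => // k _; rewrite [k.+1.-1]/= => leV wV.
have sV : (s < #|V|)%N by apply: leq_trans leV; rewrite leq_addl.
have [A [a0 As [a0A amin Amax]]] := exists_heaviest_set sV.
set om := w a0 in amin Amax.
pose Y := ~: A.
have YN : (#|Y| + s.+1)%N = #|V| by rewrite -As addnC cardsC.
have wD D : weight w D <= weight w [set: V].
  by rewrite -(setUCr D) weight_setU -?setI_eq0 ?setICr// lerDl sumr_ge0.
have shadow : (#|heavy w Y k.+1 1| <= s * #|heavy w Y k (1 - om)|)%N.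
  apply: card_heavy_shadow => // [y|D DY _]; first by rewrite inE => /Amax.
  by rewrite mulr1; apply: le_lt_trans wV; apply: wD.
(* The [s] extra blocks are matched with virtual copies of the lightest vertex
   of [A]; a heavy pair using a copy can be traded for an unused vertex of [A]. *)
pose F (j : 'I_#|A| + 'I_s) : {set {set V}} :=
  match j with
  | inl i => heavy w Y k (1 - w (enum_val i))
  | inr _ => heavy w Y k (1 - om)
  end.
have avg : (\sum_j #|F j| <= s * 'C(#|Y|, k))%N.
  apply: sum_card_matching.
  - rewrite card_sum !card_ord As; move: leV; rewrite -YN -addnn; lia.
  - by move=> [i|j] H; rewrite inE => /and3P[HY /eqP Hk _].
  move=> B BY Bd; rewrite leqNgt; apply/negP => lts.
  pose P := [set i | B (inl i) \in F (inl i)].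
  pose Q := [set j | B (inr j) \in F (inr j)].
  have PQ : (s < #|P| + #|Q|)%N.
    apply: leq_trans lts _; rewrite -[in #|Q|](card_imset _ (@inr_inj 'I_#|A| _)).
    rewrite -(card_imset (mem P) (@inl_inj _ 'I_s));
      apply: leq_trans (leq_card_setU _ _).1.
    by apply: subset_leq_card; apply/subsetP => -[i|j] h; apply/setUP; [left|right];
      apply: imset_f; move: h; rewrite !inE.
  have Ps : (#|P| <= s.+1)%N by rewrite -As -[leqRHS]card_ord max_card.
  (* Exactly [s.+1] successful blocks are kept. Paired with distinct vertices of [A] they have total
     weight at least [s.+1], against the bound on the weight of all vertices. *)
  have [Q' Q'Q Q's] := @subset_of_card _ Q (s.+1 - #|P|) ltac:(lia).
  pose J := [set j : 'I_#|A| + 'I_s |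
    match j with inl i => i \in P | inr j => j \in Q' end].
  have wY : weight w [set: V] = weight w A + weight w Y.
    by rewrite -weight_setU ?setUCr// -setI_eq0 setICr.
  have wJ := @sum_weight_disjoint _ J B Y BY Bd.
  have wP : \sum_(i in P) (1 - w (enum_val i)) + (s.+1 - #|P|)%:R * (1 - om) <= \sum_(j
    in J) weight w (B j).
    rewrite big_sumType/= lerD//.
      rewrite [leRHS](eq_bigl (mem P)) => [|i]; last by rewrite inE.
      by apply: ler_sum => i; rewrite !inE => /and3P[].
    rewrite [leRHS](eq_bigl (mem Q')) => [|i]; last by rewrite inE.
    rewrite -Q's mulr_natl -sumr_const.
    by apply: ler_sum => j /(subsetP Q'Q); rewrite !inE => /and3P[].
  have wA : \sum_(i in P) w (enum_val i) + (s.+1 - #|P|)%:R * om <= weight w A.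
    rewrite /weight [leRHS]big_enum_val/= [leRHS](bigID (mem P))/= lerD//.
    have -> : (s.+1 - #|P|)%N = #|~: P| by rewrite -As [RHS]cardsCs card_ord setCK.
    rewrite mulr_natl -sumr_const [leLHS](eq_bigl (fun i => i \notin P)) => [|i];
      last by rewrite inE.
    by apply: ler_sum => i _; apply: amin; apply: enum_valP.
  move: wV; rewrite wY; apply/negP; rewrite -leNgt.
  move: wP wA; rewrite sumrB sumr_const mulrBr mulr1 natrB//.
  lra.
have Ydis : [disjoint Y & enum A].
  by rewrite disjoint_subset; apply/subsetP => x; rewrite !inE mem_enum.
have := @card_heavy_extend R V w Y k 1 (enum A) (enum_uniq _) Ydis.
have -> : [set x in enum A] = A by apply/setP => x; rewrite inE mem_enum.
rewrite setUC setUCr -cardE As YN big_enum/=.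
move: avg; rewrite big_sumType/= sum_nat_const card_ord.
rewrite -(big_enum_val (fun a => #|heavy w Y k (1 - w a)|)).
(* Pascal's rule at [#|Y|.+1] absorbs the one copy of ['C(#|Y|, k)] by which [s.+1] copies exceed
   [s]. *)
have -> : (#|V| - s)%N = #|Y|.+1 by rewrite -YN; lia.
rewrite binS mulSn; move: shadow.
move: (\sum_(_ in _) _)%N #|heavy _ [set: V] _ _| #|heavy w Y k.+1 _|.
move: 'C(_, _) 'C(_, _) 'C(_, _) (s * #|_|)%N (s * 'C(_, _))%N => *; lia.
Qed.

End ThresholdBound.

(** * One-sided regularity *)

(* Order the points by colour and cut this order into blocks of length [p]: since
   both are monotone along the order, the colour and the block are determined by
   the sum of their indices. *)
Lemma refine_coloring (V C : finType) (chi : V -> C) :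
  0 < #|C| <= #|V| -> exists p, exists2 chi' : V -> 'I_(3 * #|C|),
    (forall c, #|[set v | chi' v == c]| <= p) /\ 3 * #|C| * p <= 3 * #|V| &
    (forall u v, chi' u = chi' v -> chi u = chi v).
Proof.
move=> /andP[C0 CV]; set n := #|V| in CV *; pose p := n %/ #|C|.
have p0 : 0 < p by rewrite divn_gt0.
pose rk v : nat := enum_rank (chi v).
pose key v := rk v * n + enum_rank v.
have rkn (v : V) : enum_rank v < n by apply: ltn_ord.
have n0 : 0 < n by apply: leq_trans CV.
have key_div v : key v %/ n = rk v by rewrite /key divnMDl// divn_small ?addn0.
have key_mod v : key v %% n = enum_rank v by rewrite /key modnMDl modn_small.
have key_inj : injective key.
  by move=> u v e; apply: enum_rank_inj; apply: val_inj; rewrite /= -!key_mod e.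
have [pos pos_lt pos_n] : exists2 pos : V -> nat,
    (forall u v, key u < key v -> pos u < pos v) & (forall v, pos v < n).
  exists (fun v => #|[set u | key u < key v]|) => [u v uv|v].
    apply: proper_card; apply/properP; split.
      by apply/subsetP => x; rewrite !inE => /ltn_trans; apply.
    by exists u; rewrite inE ?ltnn.
  rewrite /n -cardsT; apply: proper_card; apply/properP; split=> //.
  by exists v; rewrite ?inE ?ltnn.
have pos_le u v : key u <= key v -> pos u <= pos v.
  rewrite leq_eqVlt => /orP[/eqP/key_inj->//|/pos_lt/ltnW//].
have pos_inj : injective pos.
  move=> u v e; apply: key_inj; case: (ltngtP (key u) (key v)) => // /pos_lt.
    by rewrite e ltnn.
  by rewrite e ltnn.
pose idx v := rk v + pos v %/ p.
have idxP v : idx v < 3 * #|C|.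
  (* Rounding in [p = n %/ #|C|] costs at most a factor 2, as [p] is positive; the colour index
     contributes the third [#|C|]. *)
  have : pos v %/ p < 2 * #|C|.
    rewrite ltn_divLR//; apply: leq_trans (pos_n v) _.
    have := ltn_ceil n C0; rewrite -/p => h; apply: leq_trans (ltnW h) _.
    by rewrite mulSn; nia.
  have : rk v < #|C| by apply: ltn_ord.
  rewrite /idx; lia.
have idx_eq u v : idx u = idx v -> rk u = rk v /\ pos u %/ p = pos v %/ p.
  wlog le : u v / key u <= key v.
    by move=> wl; case: (leqP (key u) (key v)) => [|/ltnW] le e;
       [exact: wl|case: (wl v u le (esym e))].
  have := leq_div2r n le; rewrite !key_div.
  have := leq_div2r p (pos_le u v le); rewrite /idx; lia.
exists p; exists (fun v => Ordinal (idxP v)); last first.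
  by move=> u v /(congr1 val)/idx_eq[e _]; apply: enum_rank_inj; apply: val_inj.
split=> [c|]; last by rewrite -mulnA leq_mul2l /= mulnC leq_trunc_div.
rewrite -[p]card_ord -(card_in_imset (f := fun v => Ordinal (ltn_pmod (pos v) p0))).
  exact: max_card.
move=> u v; rewrite !inE => /eqP <- /eqP/(congr1 val)/idx_eq[_ e] /(congr1 val)/= e'.
by apply: pos_inj; rewrite (divn_eq (pos u) p) (divn_eq (pos v) p) e e'.
Qed.

(** * Boxes of tuples and colour patterns *)

Section Boxes.
Variables (r : nat) (V : finType).
Implicit Types (B : {ffun 'I_r -> {set V}}) (S : {set {ffun 'I_r -> V}}).

Definition box B : {set {ffun 'I_r -> V}} :=
  [set f : {ffun 'I_r -> V} | [forall i, f i \in B i]].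

Lemma boxP B (f : {ffun 'I_r -> V}) : reflect (forall i, f i \in B i) (f \in box B).
Proof. by rewrite inE; apply: forallP. Qed.

Lemma card_box B : #|box B| = \prod_i #|B i|.
Proof.
rewrite (eq_card (B := family (fun i => mem (B i)))) => [|f]; last by rewrite inE.
by rewrite card_family foldrE big_image.
Qed.

Definition colors K (chi : V -> 'I_K) (f : {ffun 'I_r -> V}) : {ffun 'I_r -> 'I_K} :=
  [ffun i => chi (f i)].

Definition cells K (chi : V -> 'I_K) (a : {ffun 'I_r -> 'I_K}) :
  {ffun 'I_r -> {set V}} := [ffun i => [set v | chi v == a i]].

Lemma mem_box_cells K (chi : V -> 'I_K) a f :
  (f \in box (cells chi a)) = (colors chi f == a).
Proof.
apply/boxP/eqP => [h|<- i]; last by rewrite !ffunE inE.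
by apply/ffunP => i; have := h i; rewrite !ffunE inE => /eqP.
Qed.

Lemma card_by_colors K (chi : V -> 'I_K) S :
  #|S| = \sum_a #|[set f in S | colors chi f == a]|.
Proof.
rewrite -sum1_card (partition_big (colors chi) predT)//=; apply: eq_bigr => a _.
by rewrite sum1dep_card.
Qed.

End Boxes.

Section WeakRegularity.
Variables (R : archiRealFieldType) (r : nat).
Local Open Scope ring_scope.

(** One-sided: large sub-boxes only need density at least [d]. Here [g] is an absolute size, not a
    proportion. *)
Definition lower_regular (V : finType) (E : {set {ffun 'I_r -> V}}) (d g : R)
    (B : {ffun 'I_r -> {set V}}) : bool :=
  [forall B' : {ffun 'I_r -> {set V}},
    [forall i, (B' i \subset B i) && (g <= #|B' i|%:R)] ==>
      (d * #|box B'|%:R <= #|E :&: box B'|%:R)].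

Definition regular_coloring (V : finType) (E : {set {ffun 'I_r -> V}}) (d g : R)
    K m (chi : V -> 'I_K) :=
  [/\ forall c, (#|[set v | chi v == c]| <= m)%N, (K * m <= 3 * #|V|)%N &
      #|[set f in E | ~~ lower_regular E d (g * m%:R) (cells chi (colors chi f))]|%:R
        <= 2 * d * #|V|%:R ^+ r].

(* In place of an energy increment: [Z] is a set of tuples in discarded sparse boxes,
   and its volume, which is at most [#|V| ^ r], grows at each refinement. *)
Definition sparse_stage (V : finType) (E : {set {ffun 'I_r -> V}}) (d g : R)
    j K m (chi : V -> 'I_K) (Z : {set {ffun 'I_r -> V}}) :=
  [/\ forall c, (#|[set v | chi v == c]| <= m)%N, (K * m <= 3 * #|V|)%N,
      forall f f', colors chi f = colors chi f' -> f \in Z -> f' \in Z,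
      #|E :&: Z|%:R <= d * #|Z|%:R &
      j%:R * (d * g ^+ r) * #|V|%:R ^+ r <= #|Z|%:R].

(** If many tuples outside [Z] lie in irregular boxes, then each of their colour patterns has a
    sparse sub-box as witness, and these are added to [Z]. The type [C] records the old colour and
    the membership in every side of every witness, so that the new [Z] is again a union of boxes of
    colour classes. *)
Lemma sparse_stage_step (V : finType) (E : {set {ffun 'I_r -> V}}) (d g : R)
    j K m (chi : V -> 'I_K) Z (C := ('I_K * {ffun {ffun 'I_r -> 'I_K} -> {ffun 'I_r ->
      bool}})%type) :
  0 <= d -> 0 <= g -> (0 < #|{: C}| <= #|V|)%N ->
  sparse_stage E d g j m chi Z ->
  regular_coloring E d g m chi \/
  exists m' (chi' : V -> 'I_(3 * #|{: C}|)) Z', sparse_stage E d g j.+1 m' chi' Z'.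
Proof.
move=> d0 g0 CV [cm Km Zinv EZ Zj].
pose reg a := lower_regular E d (g * m%:R) (cells chi a).
pose N := [set f | (f \notin Z) && ~~ reg (colors chi f)].
case: (lerP #|N|%:R (d * #|V|%:R ^+ r)) => [Nd|Nd].
  (* Irregular edges lie in the sparse set [Z] or in [N], each contributing at most [d * #|V| ^ r];
     hence the factor 2. *)
  left; split=> //.
  apply: (@le_trans _ _ (#|E :&: Z|%:R + #|N|%:R)).
    rewrite -natrD ler_nat; apply: leq_trans (leq_card_setU _ _).1.
    apply: subset_leq_card; apply/subsetP => f; rewrite !inE => /andP[-> ->].
    by case: (f \in Z).
  have : #|Z|%:R <= #|V|%:R ^+ r :> R.
    by rewrite -natrX ler_nat -[r in leqRHS]card_ord -card_ffun max_card.
  by move/(ler_wpM2l d0); lra.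
right.
pose wit (a : {ffun 'I_r -> 'I_K}) : pred {ffun 'I_r -> {set V}} := fun B =>
  [forall i, (B i \subset cells chi a i) && (g * m%:R <= #|B i|%:R)] &&
  (#|E :&: box B|%:R < d * #|box B|%:R).
pose W a := odflt [ffun=> set0] [pick B | wit a B].
have WP a : ~~ reg a -> wit a (W a).
  rewrite negb_forall => /existsP[B]; rewrite negb_imply -ltNge => hB.
  by rewrite /W; case: pickP => //= /(_ B); rewrite /wit hB.
pose N' := [set f in N | f \in box (W (colors chi f))].
have NinvE f f' : colors chi f = colors chi f' -> (f \in N) = (f' \in N).
  move=> e; rewrite !inE e; congr (~~ _ && _).
  by apply/idP/idP; apply: Zinv.
have N'E a f0 : f0 \in N -> colors chi f0 = a ->
    [set f in N' | colors chi f == a] = box (W a).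
  move=> f0N f0a; have /andP[/forallP WC _] : wit a (W a).
    by apply: WP; move: f0N; rewrite inE f0a => /andP[].
  have sub f : f \in box (W a) -> colors chi f = a.
    move=> /boxP h; apply/eqP; rewrite -mem_box_cells; apply/boxP => i.
    by have /andP[/subsetP/(_ _ (h i))] := WC i.
  apply/setP => f; rewrite [LHS]inE; apply/idP/idP.
    by rewrite inE => /andP[/andP[_ +] /eqP fa]; rewrite fa.
  move=> fW; have fa := sub f fW; rewrite fa eqxx andbT inE fa fW andbT.
  by rewrite (NinvE f f0)// fa.
have N'0 a : (forall f0, f0 \in N -> colors chi f0 <> a) ->
    [set f in N' | colors chi f == a] = set0.
  move=> h; apply/setP => f; rewrite [LHS]inE in_set0; apply/negP.
  by rewrite inE => /andP[/andP[/h fN _] /eqP].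
have colorP a : (exists2 f0, f0 \in N & colors chi f0 = a) \/
    (forall f0, f0 \in N -> colors chi f0 <> a).
  case: (pickP (fun f => (f \in N) && (colors chi f == a))) => [f0 /andP[fN /eqP
    fa]|none].
    by left; exists f0.
  by right => f fN fa; have := none f; rewrite fN fa eqxx.
have N'sparse : #|E :&: N'|%:R <= d * #|N'|%:R.
  rewrite (card_by_colors chi) (card_by_colors chi N') !natr_sum mulr_sumr.
  apply: ler_sum => a _; rewrite setIdE -setIA -setIdE.
  case: (colorP a) => [[f0 f0N f0a]|h]; last by rewrite N'0// setI0 cards0 mulr0.
  rewrite (N'E a f0)// ltW//.
  have : wit a (W a) by apply: WP; move: f0N; rewrite inE f0a => /andP[].
  by case/andP.
(* The sides of a witness have size at least [g * m], while a box of colour classes has at most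
   [m ^ r] tuples. *)
have N'large : g ^+ r * #|N|%:R <= #|N'|%:R.
  rewrite (card_by_colors chi N) (card_by_colors chi N') !natr_sum mulr_sumr.
  apply: ler_sum => a _; case: (colorP a) => [[f0 f0N f0a]|h]; last first.
    rewrite N'0// cards0 (_ : [set f in N | _] = set0) ?cards0 ?mulr0//.
    apply/setP => f; rewrite [LHS]inE in_set0; apply/negP => /andP[/h fN /eqP]//.
  rewrite (N'E a f0)//.
  have /andP[/forallP WC _] : wit a (W a).
    by apply: WP; move: f0N; rewrite inE f0a => /andP[].
  apply: (@le_trans _ _ (g ^+ r * m%:R ^+ r)).
    apply: ler_wpM2l; first by rewrite exprn_ge0.
    apply: (@le_trans _ _ #|box (cells chi a)|%:R).
      rewrite ler_nat; apply: subset_leq_card; apply/subsetP => f.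
      by rewrite inE mem_box_cells => /andP[].
    rewrite card_box natr_prod -[r in _ ^+ r]card_ord -prodr_const.
    by apply: ler_prod => i _; rewrite ler0n ler_nat ffunE cm.
  rewrite -exprMn card_box natr_prod -[r in _ ^+ r]card_ord -prodr_const.
  by apply: ler_prod => i _; rewrite mulr_ge0//=; have /andP[] := WC i.
have ZN' : Z :&: N' = set0.
  by apply/setP => f; rewrite !inE; case: (f \in Z).
pose chi1 v : C := (chi v, [ffun a => [ffun i => v \in W a i]]).
have [p [chi2 [cp Kp] chi12]] := @refine_coloring V C chi1 CV.
exists p, chi2, (Z :|: N'); split=> //.
- move=> f f' /ffunP ff'.
  have e i : chi1 (f i) = chi1 (f' i).
    by apply: chi12; have := ff' i; rewrite !ffunE.
  have ec : colors chi f = colors chi f'.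
    by apply/ffunP => i; rewrite !ffunE; have /(congr1 fst) := e i.
  rewrite !inE => /orP[/(Zinv _ _ ec)->//|].
  rewrite -!(in_set (fun f => (f \notin Z) && ~~ reg (colors chi f))) -/N.
  move=> /andP[fN /forallP fW]; apply/orP; right.
  rewrite -(NinvE _ _ ec) fN -ec; apply/forallP => i.
  have /(congr1 snd)/= /ffunP/(_ (colors chi f)) := e i; rewrite !ffunE => /ffunP/(_ i).
  by rewrite !ffunE => <-; apply: fW.
- by rewrite setIUr !cardsU setIACA setIid ZN' setI0 cards0 !subn0 !natrD mulrDr lerD.
- rewrite cardsU ZN' cards0 subn0.
  rewrite natrD -natr1 !mulrDl lerD// mul1r mulrAC mulrC.
  apply: le_trans N'large; apply: ler_wpM2l; first by rewrite exprn_ge0.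
  exact: ltW.
Qed.

(** Each further stage adds [d * g ^+ r * #|V| ^+ r] to the volume of the sparse set, so some stage
    below a bound of [(d * g ^+ r)^-1] must end regular; the number of colours at stage [j] does not
    depend on [V]. *)
Lemma weak_regularity (d g : R) : 0 < d -> 0 < g ->
  exists K0 : nat, forall (V : finType) (E : {set {ffun 'I_r -> V}}), (K0 <= #|V|)%N ->
    exists K m (chi : V -> 'I_K), (K <= K0)%N /\ regular_coloring E d g m chi.
Proof.
move=> d0 g0.
have stages j : exists2 K0 : nat, (0 < K0)%N &
    forall (V : finType) (E : {set {ffun 'I_r -> V}}), (K0 <= #|V|)%N ->
      (exists K m (chi : V -> 'I_K), (K <= K0)%N /\ regular_coloring E d g m chi) \/
      (exists m (chi : V -> 'I_K0) Z, sparse_stage E d g j m chi Z).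
  elim: j => [|j [K0 K00 IH]].
    exists 1%N => // V E _; right; exists #|V|, (fun=> ord0), set0; split.
    - by move=> c; apply: max_card.
    - by rewrite mul1n leq_pmull.
    - by move=> f f'; rewrite inE.
    - by rewrite setI0 !cards0 mulr0.
    - by rewrite !mul0r cards0.
  pose C := ('I_K0 * {ffun {ffun 'I_r -> 'I_K0} -> {ffun 'I_r -> bool}})%type.
  have C1 : (0 < #|{: C}|)%N.
    by rewrite card_prod card_ord muln_gt0 K00 !card_ffun !expn_gt0 card_bool.
  have CK : (K0 <= #|{: C}|)%N.
    by rewrite card_prod card_ord leq_pmulr// !card_ffun !expn_gt0 card_bool.
  exists (3 * #|{: C}|)%N; first by rewrite muln_gt0.
  move=> V E CV; case: (IH V E) => [|[K [m [chi [KK0 h]]]]|[m [chi [Z h]]]].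
  - by apply: leq_trans CK (leq_trans _ CV); rewrite leq_pmull.
  - left; exists K, m, chi; split=> //.
    by apply: leq_trans KK0 (leq_trans CK _); rewrite leq_pmull.
  case: (sparse_stage_step (ltW d0) (ltW g0) _ h) => [|h'|h'].
  - by rewrite C1/=; apply: leq_trans CV; rewrite leq_pmull.
  - left; exists K0, m, chi; split=> //.
    by apply: leq_trans CK _; rewrite leq_pmull.
  - by right.
have dg : 0 < d * g ^+ r by rewrite mulr_gt0// exprn_gt0.
have [K0 K00 h] := stages (Num.bound (d * g ^+ r)^-1).
exists K0 => V E VK; case: (h V E VK) => // -[m [chi [Z [_ _ _ _]]]].
have V0 : 0 < #|V|%:R ^+ r :> R by rewrite exprn_gt0// ltr0n (leq_trans K00).
have : #|Z|%:R <= #|V|%:R ^+ r :> R.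
  by rewrite -natrX ler_nat -[r in leqRHS]card_ord -card_ffun max_card.
have := archi_boundP (ltW (etrans (invr_gt0 _) dg)).
rewrite -(ltr_pM2r dg) mulVf ?gt_eqF// -(ltr_pM2r V0) mul1r.
by move=> h1 h2 h3; have := lt_le_trans h1 (le_trans h3 h2); rewrite ltxx.
Qed.

End WeakRegularity.

(** * Tight paths and tight linear forests *)

Section TightPaths.
Variables (r' : nat) (V : finType).
Local Notation r := r'.+1.
Implicit Types (B : {ffun 'I_r -> {set V}}) (f : {ffun 'I_r -> V}).
Implicit Types (H : {set {ffun 'I_r -> V}}) (G : {set {set V}}) (s : seq V).

Definition update f (i : 'I_r) v : {ffun 'I_r -> V} :=
  [ffun j => if j == i then v else f j].

Lemma update_id f i : update f i (f i) = f.
Proof. by apply/ffunP => j; rewrite ffunE; case: eqP => [->|]. Qed.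

Lemma update_update f i u v : update (update f i u) i v = update f i v.
Proof. by apply/ffunP => j; rewrite !ffunE; case: (j == i). Qed.

Definition degree H f i := #|[set v | update f i v \in H]|.

(** The filler [x0] replaces the deleted coordinate, so that shadows are still families of
    [r]-tuples. *)
Definition shadow_size (x0 : V) H := \sum_(i < r) #|[set update f i x0 | f in H]|.

(* A subfamily maximising [#|H| - D * shadow_size H] has large degrees, since
   deleting all members through a shadow element of degree less than [D] would
   increase this quantity. *)
Lemma min_degree_subfamily x0 H0 D : D * shadow_size x0 H0 < #|H0| ->
  exists2 H : {set {ffun 'I_r -> V}}, H \subset H0 & H != set0 /\
    forall f i, f \in H -> D <= degree H f i.
Proof.
move=> hD; pose sh := shadow_size x0.
have shS H H' : H \subset H' -> sh H <= sh H'.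
  by move=> HH'; apply: leq_sum => i _; apply/subset_leq_card/imsetS.
(* The shift by [D * sh H0] keeps the natural-number subtraction from truncating. *)
have [H HH0 Hmax] := @arg_maxnP _ H0 (fun H => H \subset H0) (fun H => #|H| + D * (sh
  H0 - sh H)) (subxx _).
exists H => //; split.
  apply/eqP => H_0; have /= := Hmax H0 (subxx _);
    rewrite subnn muln0 addn0 H_0 cards0 add0n leqNgt.
  move=> /negP; apply; apply: leq_ltn_trans hD; rewrite leq_mul2l.
  by apply/orP; right; apply: leq_subr.
move=> f i fH; rewrite leqNgt; apply/negP => ltD.
pose H' := [set g in H | update g i x0 != update f i x0].
have H'H : H' \subset H by apply/subsetP => g; rewrite inE => /andP[].
have /= := Hmax H' (subset_trans H'H HH0); apply/negP; rewrite -ltnNge.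
have c1 : #|H| <= #|H'| + degree H f i.
  rewrite -(cardsID [set g | update g i x0 == update f i x0] H) addnC leq_add//.
    by apply: subset_leq_card; apply/subsetP => g; rewrite !inE => /andP[-> ->].
  rewrite /degree; apply: leq_trans (leq_imset_card (update f i) (mem [set v | update f
    i v \in H])).
  apply: subset_leq_card; apply/subsetP => g; rewrite !inE => /andP[gH /eqP e].
  have -> : g = update f i (g i) by rewrite -(update_update f i x0) -e update_update
    update_id.
  apply: imset_f; rewrite inE.
  by rewrite -(update_update f i x0) -e update_update update_id.
have c2 : sh H' < sh H.
  rewrite /sh /shadow_size (bigD1 i)//= [ltnRHS](bigD1 i)//= -addSn leq_add//.
    apply: proper_card; apply/properP; split; first exact: imsetS.
    exists (update f i x0); first exact: imset_f.
    by apply/negP => /imsetP[g]; rewrite inE => /andP[_ /eqP gf] e; apply: gf.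
  by apply: leq_sum => j _; apply/subset_leq_card/imsetS.
have b0 := shS _ _ HH0.
have : D * (sh H0 - sh H) + D <= D * (sh H0 - sh H').
  by rewrite -mulnSr leq_mul2l; apply/orP; right; lia.
by move: c1 ltD; move: (D * _) (D * _) (degree _ _ _) #|H'| #|H| => *; lia.
Qed.

Lemma shadow_size_le x0 H B m : H \subset box B -> (forall i, #|B i| <= m) ->
  shadow_size x0 H <= r * m ^ r'.
Proof.
move=> HB Bm; rewrite /shadow_size -[X in _ <= X * _]card_ord -sum_nat_const.
apply: leq_sum => i _.
pose B' := [ffun j => if j == i then [set x0] else B j].
apply: (@leq_trans #|box B'|).
  apply: subset_leq_card; apply/subsetP => _ /imsetP[f /(subsetP HB)/boxP fB ->].
  by apply/boxP => j; rewrite !ffunE; case: eqP => // _; rewrite inE.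
rewrite card_box (bigD1 i)//= ffunE eqxx cards1 mul1n.
apply: (@leq_trans (\prod_(j < r | j != i) m)).
  by apply: leq_prod => j /negPf ji; rewrite ffunE ji.
rewrite prod_nat_const (eq_card (B := predC1 i)) => [|j]; last by [].
by rewrite cardC1 card_ord.
Qed.

(** Position [q] of a path belongs to coordinate [q] modulo [r], so sliding a window by one replaces
    a single coordinate of its tuple. *)
Definition modr q : 'I_r := Ordinal (ltn_pmod q (ltn0Sn r')).

(** The path grows at its end: the oldest coordinate of the last window has at least [D] admissible
    replacements, and fewer than [D] vertices are already used. *)
Lemma greedy_tight_path x0 H D l : H != set0 ->
  (forall f, f \in H -> injective f) ->
  (forall f i, f \in H -> D <= degree H f i) -> r <= l <= D ->
  exists s, [/\ size s = l, uniq s & forall k, k + r <= l ->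
    exists2 f, f \in H & forall q, k <= q < k + r -> nth x0 s q = f (modr q)].
Proof.
move=> /set0Pn[f0 f0H] Hinj Hdeg /andP[rl]; rewrite -(subnK rl);
  move: (l - r) => n {l rl}.
elim: n => [_|n IHn nD].
  exists (map f0 (enum 'I_r)); rewrite add0n; split.
  - by rewrite size_map size_enum_ord.
  - by rewrite map_inj_uniq ?enum_uniq//; apply: Hinj.
  move=> k; rewrite -[leqRHS]add0n leq_add2r leqn0 => /eqP->.
  exists f0 => // q /= qr; rewrite (nth_map ord0) ?size_enum_ord//; congr (f0 _).
  by apply: val_inj; rewrite /= nth_enum_ord// modn_small.
have [s [ss us sW]] := IHn (ltnW nD).
have [f fH fs] := sW n (leqnn _).
have : ~~ ([set v | update f (modr n) v \in H] \subset s).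
  apply/negP => /subset_leq_card; apply/negP; rewrite -ltnNge.
  apply: leq_ltn_trans (card_size s) _; rewrite ss.
  by apply: leq_trans (Hdeg f (modr n) fH).
case/subsetPn => v; rewrite inE => vH vs.
exists (rcons s v); split; first by rewrite size_rcons ss.
  by rewrite rcons_uniq vs.
move=> k; rewrite addSn leq_eqVlt => /orP[/eqP e|].
  have {e} -> : k = n.+1 by lia.
  exists (update f (modr n) v) => // q /andP[nq]; rewrite addSn ltnS leq_eqVlt.
  rewrite nth_rcons ss ffunE => /orP[/eqP->|qn].
    rewrite ltnn eqxx ifT//; apply/eqP/val_inj; by rewrite /= modnDr.
  rewrite qn ifF ?fs ?qn ?(ltnW nq)//.
  apply/negP => /eqP/(congr1 val)/= /eqP; rewrite eqn_mod_dvd; last exact: ltnW.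
  by move/dvdn_leq; rewrite subn_gt0 nq => /(_ isT); lia.
rewrite ltnS => kn; have [g gH gs] := sW k kn; exists g => // q qk.
by rewrite nth_rcons ss ifT ?gs//; lia.
Qed.

(** The shadow has size at most [r * m ^ r'], so more than [l] times as many tuples leave a
    subfamily of minimum degree [l], in which the greedy path is found. *)
Lemma tight_path_in_dense_box G B m l :
  Defs.rgraph r G -> (forall i, #|B i| <= m) -> r <= l ->
  l * (r * m ^ r') < #|[set f in box B | [set f i | i in 'I_r] \in G]| ->
  exists s, [/\ size s = l, uniq s, windows r s \subset G &
    forall x0 q, q < l -> nth x0 s q \in B (modr q)].
Proof.
move=> Gr Bm rl; set H0 := [set f in _ | _] => hH0.
have /card_gt0P[g0 _] : 0 < #|H0| by apply: leq_ltn_trans hH0.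
pose x0 := g0 ord0.
have H0B : H0 \subset box B by apply/subsetP => f; rewrite inE => /andP[].
have := @min_degree_subfamily x0 H0 l; case.
  by apply: leq_ltn_trans hH0; rewrite leq_mul2l (shadow_size_le _ H0B)// orbT.
move=> H HH0 [HN0 Hdeg].
have HG f : f \in H -> [set f i | i in 'I_r] \in G.
  by move/(subsetP HH0); rewrite inE => /andP[].
have Hcard f : f \in H -> #|[set f i | i in 'I_r]| = r.
  by move/HG => fG; move/forallP: Gr => /(_ [set f i | i in 'I_r]) /implyP/(_ fG)/eqP.
have Hinj f : f \in H -> injective f.
  move/Hcard => fr; have : {in 'I_r &, injective f} by apply/imset_injP;
    rewrite fr card_ord.
  by move=> inj x y; apply: inj.
have [|s [ss us sW]] := @greedy_tight_path x0 H l l HN0 Hinj Hdeg;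
  first by rewrite rl leqnn.
exists s; split=> //.
  apply/subsetP => _ /imsetP[[k /= ks] _ ->]; rewrite ss in ks.
  have kl : k + r <= l by lia.
  have [f fH fs] := sW k kl.
  have -> : [set x in take r (drop k s)] = [set f i | i in 'I_r]; last exact: HG.
  have sz : size (take r (drop k s)) = r by rewrite size_takel// size_drop ss; lia.
  apply/eqP; rewrite eqEcard Hcard// cardsE (card_uniqP _) ?sz ?leqnn ?andbT; last first.
    by rewrite take_uniq// drop_uniq.
  apply/subsetP => x; rewrite inE => /(nthP x0)[q]; rewrite sz => qr <-.
  by rewrite nth_take// nth_drop fs ?imset_f// leq_addr ltn_add2l.
move=> y q ql; rewrite (set_nth_default x0) ?ss//.
have [k kl qk] : exists2 k, k + r <= l & k <= q < k + r.
  by exists (minn q (l - r)); rewrite /minn; case: ltnP; lia.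
have [f fH fs] := sW k kl; rewrite fs//.
by apply/boxP; apply: (subsetP H0B); apply: (subsetP HH0).
Qed.

End TightPaths.

(** * Path systems as tight linear forests *)

Section Windows.
Variables (r : nat) (V : finType).
Implicit Types (s : seq V) (ss : seq (seq V)) (e : {set V}).

Lemma windowsP s e : reflect (exists2 k, k + r <= size s & e = [set x in take r (drop k
  s)])
  (e \in windows r s).
Proof.
apply: (iffP imsetP) => [[[k /= ks] _ ->]|[k ks ->]]; first by exists k => //; lia.
have ks' : k < (size s).+1 - r by lia.
by exists (Ordinal ks').
Qed.

Lemma mem_window x0 s k x : k + r <= size s ->
  reflect (exists2 q, k <= q < k + r & x = nth x0 s q) (x \in take r (drop k s)).
Proof.
move=> ks; have sz : size (take r (drop k s)) = r by rewrite size_takel// size_drop; lia.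
apply: (iffP (nthP x0)); rewrite sz => -[q qr].
  by rewrite nth_take// nth_drop => <-; exists (k + q) => //; lia.
by move=> ->; exists (q - k); rewrite ?nth_take ?nth_drop ?subnKC//; lia.
Qed.

Lemma card_window s e : uniq s -> e \in windows r s -> #|e| = r.
Proof.
move=> us /windowsP[k ks ->]; rewrite cardsE (card_uniqP _).
  by rewrite size_takel// size_drop; lia.
by rewrite take_uniq// drop_uniq.
Qed.

Lemma window_sub s e x : e \in windows r s -> x \in e -> x \in s.
Proof. by move=> /windowsP[k ks ->]; rewrite inE => /mem_take/mem_drop. Qed.

Lemma windows_short s : size s < r -> windows r s = set0.
Proof.
move=> sr; apply/setP => e; rewrite inE; apply/windowsP => -[k]; lia.
Qed.

Lemma card_windows s : 0 < r -> uniq s -> #|windows r s| = (size s).+1 - r.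
Proof.
move=> r0 us; rewrite card_imset ?card_ord// => -[i /= si] -[j /= sj] e.
apply: val_inj => /=.
wlog ij : i j si sj e / i <= j.
  move=> wl; case: (leqP i j) => [|/ltnW] h; first exact: wl.
  by apply/esym; apply: (wl j i sj si) => //; apply/esym.
have x0 : V by case: (s) si => [|x t] //= ?; exfalso; lia.
have ir : i + r <= size s by lia.
have jr : j + r <= size s by lia.
have : nth x0 s i \in [set x in take r (drop i s)].
  by rewrite inE; apply/(mem_window x0 _ ir); exists i => //; lia.
rewrite e inE => /(mem_window x0 _ jr)[q qj /eqP].
rewrite nth_uniq//; [move=> /eqP iq|..].
- by apply/eqP; rewrite eqn_leq ij iq; case/andP: qj.
- by apply: leq_trans ir; rewrite -[i in i < _]addn0 ltn_add2l.
by apply: leq_trans jr; case/andP: qj.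
Qed.

Lemma windows_take s m : windows r (take m s) \subset windows r s.
Proof.
apply/subsetP => e /windowsP[k]; rewrite size_take_min => km ->.
apply/windowsP; exists k; first by apply: leq_trans km (geq_minr _ _).
have {}km : k + r <= m := leq_trans km (geq_minl _ _).
rewrite -[m in take m s](subnK (leq_trans (leq_addr r k) km)) -take_drop take_takel//.
by rewrite leq_subRL// (leq_trans (leq_addr r k) km).
Qed.

(** A path system is encoded by its vertex sequences, with disjointness expressed as
    [uniq (flatten ss)]. *)
Definition path_edges ss : {set {set V}} := [set e | has (fun s => e \in windows r s) ss].

Lemma path_edgesP ss e :
  reflect (exists2 s, s \in ss & e \in windows r s) (e \in path_edges ss).
Proof. by rewrite inE; apply: hasP. Qed.

Lemma flatten_uniq_eq ss s s' x : uniq (flatten ss) ->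
  s \in ss -> s' \in ss -> x \in s -> x \in s' -> s = s'.
Proof.
elim: ss => //= t ss IH; rewrite cat_uniq => /and3P[_ /hasPn tss uss].
have no u : u \in ss -> x \in u -> x \in t -> False.
  by move=> uss' xu xt; have := tss x; rewrite xt => /(_ _)/negP; apply => //;
    apply/flattenP; exists u.
rewrite !inE => /orP[/eqP->|h] /orP[/eqP->|h'] xs xs' //.
- by case: (no s').
- by case: (no s).
exact: IH.
Qed.

Lemma flatten_uniq_mem ss s : uniq (flatten ss) -> s \in ss -> uniq s.
Proof.
elim: ss => //= t ss IH; rewrite cat_uniq => /and3P[ut _ uss].
by rewrite inE => /orP[/eqP->//|]; apply: IH.
Qed.

Lemma card_path_edges ss : 0 < r -> uniq (flatten ss) ->
  #|path_edges ss| = \sum_(s <- ss) ((size s).+1 - r).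
Proof.
move=> r0; elim: ss => [_|s ss IH].
  by rewrite big_nil; apply/eqP; rewrite cards_eq0; apply/eqP/setP => e; rewrite !inE.
move=> us; move: (us); rewrite /= cat_uniq => /and3P[us1 /hasPn dis uss].
rewrite big_cons -IH// -card_windows//.
have -> : path_edges (s :: ss) = windows r s :|: path_edges ss.
  by apply/setP => e; rewrite !inE.
rewrite cardsU (_ : _ :&: _ = set0) ?cards0 ?subn0//.
apply/setP => e; rewrite in_set0; apply/negP;
  rewrite inE => /andP[es /path_edgesP[s' s'ss es']].
have /card_gt0P[x xe] : 0 < #|e| by rewrite (card_window us1 es).
have := dis x; rewrite (window_sub es xe) => /(_ _)/negP; apply => //.
by apply/flattenP; exists s' => //; apply: window_sub es' xe.
Qed.

Lemma adjacent_sym (E : {set {set V}}) : symmetric (adjacent E).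
Proof. by move=> x y; rewrite /adjacent;
  under eq_existsb do rewrite [in X in _ && X]andbC. Qed.

(** Consecutive vertices share a window because [r] is at least 2. *)
Lemma connect_path_edges ss s x y : 1 < r -> r <= size s -> s \in ss ->
  x \in s -> y \in s -> connect (adjacent (path_edges ss)) x y.
Proof.
move=> r1 rs sss; have csym := sym_connect_sym (@adjacent_sym (path_edges ss)).
suff h0 q : q < size s -> connect (adjacent (path_edges ss)) (nth x s 0) (nth x s q).
  move=> /(nthP x)[i si <-] /(nthP x)[j sj <-].
  by apply: (connect_trans (y := nth x s 0)); [rewrite csym|]; apply: h0.
elim: q => [|q IH] qs; first exact: connect0.
apply: connect_trans (IH (ltnW qs)) (connect1 _).
pose k := minn q (size s - r).
have kr : k + r <= size s by rewrite /k; lia.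
apply/existsP; exists [set x in take r (drop k s)]; apply/and3P; split.
- by apply/path_edgesP; exists s => //; apply/windowsP; exists k.
- by rewrite inE; apply/(mem_window x _ kr); exists q => //; rewrite /k; lia.
- by rewrite inE; apply/(mem_window x _ kr); exists q.+1 => //; rewrite /k; lia.
Qed.

(** A sequence carrying an edge is connected and closed under adjacency, hence a component; all
    other vertices are isolated. *)
Lemma tight_linear_forest_path_edges ss : 1 < r -> uniq (flatten ss) ->
  tight_linear_forest r (path_edges ss).
Proof.
move=> r1 uss; apply/andP; split.
  apply/forallP => e; apply/implyP => /path_edgesP[s sss es].
  by rewrite (card_window (flatten_uniq_mem uss sss) es).
apply/forallP => x /=; set C := component _ x.
have xC : x \in C by rewrite inE connect0.
case: (boolP [exists e in path_edges ss, x \in e]) => [|no].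
  move=> /existsP[e0 /andP[/path_edgesP[s sss e0s] xe0]].
  have xs := window_sub e0s xe0; have us := flatten_uniq_mem uss sss.
  have rs : r <= size s.
    by rewrite leqNgt; apply/negP => /windows_short s0; rewrite s0 inE in e0s.
  have sub y z : adjacent (path_edges ss) y z -> y \in s -> z \in s.
    move=> /existsP[e /and3P[/path_edgesP[s' s'ss es'] ye ze]] ys.
    rewrite (flatten_uniq_eq uss sss s'ss ys (window_sub es' ye)).
    exact: window_sub es' ze.
  have clo : closed (adjacent (path_edges ss)) (mem s).
    move=> y z yz; apply/idP/idP; first exact: sub.
    by apply: sub; rewrite adjacent_sym.
  have CE : C = [set y in s].
    apply/setP => y; rewrite !inE; apply/idP/idP; last exact: connect_path_edges.
    by move/(closed_connect clo) => <-.
  have sC : size s == #|C| by rewrite CE cardsE (card_uniqP us).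
  apply/orP; left; apply/existsP; exists (Tuple sC) => /=; apply/and3P; split=> //.
    by apply/eqP; rewrite [RHS]CE.
  apply/eqP/setP => e; rewrite inE; apply/andP/idP => [[/path_edgesP[s' s'ss es'] eC]|es].
    have /card_gt0P[y ye] : 0 < #|e|.
      by rewrite (card_window (flatten_uniq_mem uss s'ss) es') ltnW.
    have ys : y \in s by have := subsetP eC y ye; rewrite CE inE.
    by rewrite (flatten_uniq_eq uss sss s'ss ys (window_sub es' ye)).
  split; first by apply/path_edgesP; exists s.
  by apply/subsetP => y ye; rewrite CE inE (window_sub es ye).
have CE : C = [set x].
  have clo : closed (adjacent (path_edges ss)) (pred1 x).
    move=> y z /existsP[e /and3P[eE ye ze]]; move/existsPn: no => /(_ e).
    rewrite eE /= => xe; apply/eqP/eqP => h; move: xe; by rewrite -h ?ye ?ze.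
  apply/setP => y; rewrite !inE; apply/idP/eqP => [|->]; last exact: connect0.
  by move/(closed_connect clo); rewrite !inE eqxx => /esym/eqP.
apply/orP; right; apply/andP; split; first by rewrite CE cards1.
apply/eqP/setP => e; rewrite !inE; apply/negP => /andP[eE eC].
have eE' : e \in path_edges ss by rewrite inE.
move: (eE') => /path_edgesP[s sss es].
have /card_gt0P[y ye] : 0 < #|e|.
  by rewrite (card_window (flatten_uniq_mem uss sss) es) ltnW.
have := subsetP eC y ye; rewrite CE inE => /eqP yx.
by move/existsPn: no => /(_ e); rewrite eE' -yx ye.
Qed.

(** Paths are dropped from the front, and the first one that cannot be dropped is shortened, one
    edge per vertex. *)
Lemma trim_paths ss k (P : pred {set V}) : 0 < r -> uniq (flatten ss) ->
  (forall s e, s \in ss -> e \in windows r s -> P e) ->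
  k <= \sum_(s <- ss) ((size s).+1 - r) ->
  exists ss', [/\ uniq (flatten ss'),
    forall s e, s \in ss' -> e \in windows r s -> P e &
    \sum_(s <- ss') ((size s).+1 - r) = k].
Proof.
move=> r0; elim: ss k => [k _ _|s ss IH k].
  by rewrite big_nil leqn0 => /eqP->; exists [::]; split=> //; rewrite big_nil.
rewrite big_cons /= cat_uniq => /and3P[us /hasPn dis uss] hP hk.
have hP' s' e : s' \in ss -> e \in windows r s' -> P e.
  by move=> s'ss; apply: hP; rewrite inE s'ss orbT.
case: (leqP k (\sum_(j <- ss) ((size j).+1 - r))) => hk'.
  exact: IH.
set q := \sum_(_ <- ss) _ in hk hk'.
(* This prefix has exactly [k - q] windows. *)
exists (take (k - q + r.-1) s :: ss); split.
- rewrite /= cat_uniq take_uniq// uss andbT /=; apply/hasPn => x /dis.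
  by apply: contra; apply: mem_take.
- move=> s' e; rewrite inE => /orP[/eqP->|]; last exact: hP'.
  by move/(subsetP (windows_take _ _)); apply: hP; rewrite inE eqxx.
by rewrite big_cons -/q size_takel; lia.
Qed.

End Windows.

Lemma contains_tight_linear_forest r n k (G : {set {set 'I_n}}) (ss : seq (seq 'I_n)) :
  1 < r -> uniq (flatten ss) -> (forall s, s \in ss -> windows r s \subset G) ->
  k <= \sum_(s <- ss) ((size s).+1 - r) ->
  exists2 H, H \in tight_linear_forests r n k & contains_copy G H.
Proof.
move=> r1 uss ssG hk; have r0 := ltnW r1.
have [|ss' [u' G' k']] := @trim_paths r _ ss k (mem G) r0 uss _ hk.
  by move=> s e sss; apply: (subsetP (ssG s sss)).
exists (path_edges r ss').
  by rewrite inE tight_linear_forest_path_edges// card_path_edges// k'/=.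
apply/existsP; exists [ffun x => x]; apply/andP; split.
  by apply/injectiveP => x y; rewrite !ffunE.
apply/forallP => e; apply/implyP => /path_edgesP[s s' es].
rewrite (eq_imset (g := id)) => [|x]; last by rewrite ffunE.
by rewrite imset_id; apply: G' es.
Qed.

(** An edge through [v] is a window starting [j] places before [v], for some [j < r]. *)
Lemma tight_linear_forest_degree (W : finType) r (H : {set {set W}}) v :
  tight_linear_forest r H -> #|[set e in H | v \in e]| <= r.
Proof.
move=> /andP[_ /forallP/(_ v)] /=; set C := component H v.
have eC e : e \in H -> v \in e -> e \in edges_in H C.
  move=> eH ve; rewrite inE eH; apply/subsetP => y ye; rewrite inE.
  by apply: connect1; apply/existsP; exists e; rewrite eH ve ye.
case/orP => [/existsP[s /and3P[us _ /eqP Cw]]|/andP[_ /eqP C0]]; last first.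
  rewrite (_ : [set _ in _ | _] = set0) ?cards0//; apply/setP => e;
    rewrite [LHS]inE [RHS]inE.
  by apply/negP => /andP[eH ve]; have := eC e eH ve; rewrite C0 inE.
rewrite -[leqRHS]card_ord.
apply: leq_trans (leq_imset_card (fun j : 'I_r => [set x in take r (drop (index v s -
  j) s)]) 'I_r).
apply: subset_leq_card; apply/subsetP => e; rewrite inE => /andP[eH ve].
have := eC e eH ve; rewrite Cw => /windowsP[k ks ee].
move: ve; rewrite ee inE => /(mem_window v _ ks)[q qk vq].
have qs : q < size s by apply: leq_trans ks; case/andP: qk.
have -> : k = index v s - (q - k) by rewrite vq index_uniq//; lia.
have qkr : q - k < r by lia.
by apply/imsetP; exists (Ordinal qkr).
Qed.

Lemma turan_lower_bound r n k s : s <= n -> r * s < k ->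
  'C(n, r) - 'C(n - s, r) <= turan r n (tight_linear_forests r n k).
Proof.
move=> sn rsk.
have [S _ Ss] : exists2 S : {set 'I_n}, S \subset setT & #|S| = s.
  by apply: subset_of_card; rewrite cardsT card_ord.
pose G := [set e : {set 'I_n} | (#|e| == r) && ~~ (e \subset ~: S)].
have Gcard : #|G| = 'C(n, r) - 'C(n - s, r).
  rewrite -[n in 'C(n, r)]card_ord -card_draws.
  have -> : n - s = #|~: S| by rewrite cardsCs setCK card_ord Ss.
  rewrite -cards_draws -(cardsID [set e : {set 'I_n} | e \subset ~: S] [set e : {set
    'I_n} | #|e| == r]).
  rewrite (_ : _ :&: _ = [set A : {set 'I_n} | A \subset ~: S & #|A| == r]).
    by rewrite addKn; apply: eq_card => e; rewrite !inE andbC.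
  by apply/setP => e; rewrite !inE andbC.
rewrite -Gcard; apply: (@leq_bigmax_cond _ _ (fun G : {set {set 'I_n}} => #|G|)).
apply/andP; split; first by apply/forallP => e; apply/implyP; rewrite inE => /andP[].
apply/forallP => H; apply/implyP; rewrite inE => /andP[Hf /eqP Hk].
apply/negP => /existsP[f /andP[/injectiveP finj /forallP HG]].
move: rsk; apply/negP; rewrite -leqNgt -Hk.
(* Every edge of the copied forest has a vertex sent into [S]; there are at most [s] such vertices,
   each of degree at most [r]. *)
apply: (@leq_trans (\sum_(v in f @^-1: S) #|[set e in H | v \in e]|)).
  under eq_bigr do rewrite -sum1_card.
  rewrite (exchange_big_dep (mem H))/=; last by move=> v e _; rewrite inE => /andP[].
  rewrite -[#|H|]sum1_card; apply: leq_sum => e eH; rewrite sum1dep_card.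
  move: (HG e); rewrite eH inE => /andP[_ /subsetPn[_ /imsetP[v ve ->]]].
  rewrite inE negbK => vS; apply/card_gt0P; exists v.
  by rewrite !inE vS eH ve.
apply: (@leq_trans (\sum_(v in f @^-1: S) r)).
  by apply: leq_sum => v _; apply: tight_linear_forest_degree.
rewrite sum_nat_const mulnC leq_mul2l; apply/orP; right.
by rewrite -Ss -(card_imset _ finj);
  apply/subset_leq_card/subsetP => _ /imsetP[v + ->]; rewrite inE.
Qed.

(** * The asymptotic bounds *)

Lemma sum_modr r' t (h : 'I_r'.+1 -> nat) :
  \sum_(0 <= q < t * r'.+1) h (modr r' q) = t * \sum_i h i.
Proof.
elim: t => [|t IH]; first by rewrite !mul0n big_nil.
rewrite mulSnr (big_cat_nat _ (n := t * r'.+1)) ?leq_addr//= IH mulSnr; congr (_ + _).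
rewrite -{1}[t * _]add0n big_addn addKn big_mkord; apply: eq_bigr => i _.
by congr h; apply: val_inj; rewrite /= addnC modnMDl modn_small.
Qed.

Lemma leq_bin_expn n k : 'C(n, k) <= n ^ k.
Proof.
elim: n k => [|n IH] [|k]; rewrite ?bin0 ?expn0// binS.
apply: leq_trans (leq_add (IH k.+1) (IH k)) _.
have h : n ^ k <= n.+1 ^ k by case: (k) => // j; rewrite leq_exp2r.
by rewrite !expnS mulSn addnC leq_add// leq_mul2l h orbT.
Qed.

Lemma bin_sub_le n s0 s k : s0 <= s ->
  'C(n - s0, k.+1) <= 'C(n - s, k.+1) + (s - s0) * n ^ k.
Proof.
move=> s0s; rewrite -{1}(subnK s0s); elim: (s - s0) => [|u IH].
  by rewrite add0n leq_addr.
apply: leq_trans IH _; rewrite mulSnr addSn.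
rewrite [X in _ <= _ + X]addnC addnA leq_add2r.
case: (posnP (n - (u + s0))) => [e|]; first by rewrite e bin0n.
move=> pos; have -> : n - (u + s0) = (n - (u + s0).+1).+1 by lia.
rewrite binS leq_add2l; apply: leq_trans (leq_bin_expn _ _) _.
by case: (k) => // j; rewrite leq_exp2r// leq_subr.
Qed.

(** * Disjoint tight paths in lower regular tuples *)

Section Tilings.
Variables (R : archiRealFieldType) (r' n K m t : nat) (chi : 'I_n -> 'I_K).
Variables (G : {set {set 'I_n}}) (d g : R).
Local Notation r := r'.+1.
Local Open Scope ring_scope.

Definition edge_tuples : {set {ffun 'I_r -> 'I_n}} :=
  [set f : {ffun 'I_r -> 'I_n} | [set f i | i in 'I_r] \in G].

(** A class may occur several times in [a]; a path on [t * r] vertices along [a] takes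
    [t * multiplicity a c] vertices of class [c]. *)
Definition multiplicity (a : {ffun 'I_r -> 'I_K}) c := #|[set i | a i == c]|.

Lemma disjoint_tight_paths (L : seq {ffun 'I_r -> 'I_K}) :
  0 <= d -> 0 <= g ->
  Defs.rgraph r G -> (0 < t)%N ->
  (forall c, (#|[set v | chi v == c]| <= m)%N) ->
  (forall a, a \in L -> lower_regular edge_tuples d (g * m%:R) (cells chi a)) ->
  (forall a i, a \in L -> (t * \sum_(a' <- L) multiplicity a' (a i))%:R + g * m%:R
     <= #|[set v | chi v == a i]|%:R) ->
  ((t * r) * (r * m ^ r'))%:R < d * (g * m%:R) ^+ r ->
  exists ss : seq (seq 'I_n), [/\ uniq (flatten ss), size ss = size L,
    forall s, s \in ss -> size s = (t * r)%N /\ windows r s \subset G &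
    forall c, count (fun v => chi v == c) (flatten ss) = (t * \sum_(a <- L)
      multiplicity a c)%N].
Proof.
move=> d0 g0 Gr t0 cm + + dense; elim: L => [|a L IH] Lreg Lroom.
  by exists [::]; split=> // c; rewrite big_nil muln0.
have [||ss [uss sss ssG ssc]] := IH.
- by move=> a' a'L; apply: Lreg; rewrite inE a'L orbT.
- move=> a' i a'L; apply: le_trans (Lroom a' i _); last by rewrite inE a'L orbT.
  by rewrite lerD2r ler_nat big_cons leq_mul2l leq_addl orbT.
pose B : {ffun 'I_r -> {set 'I_n}} := [ffun i => [set v | chi v == a i] :\: [set v in
  flatten ss]].
have Bsub i : B i \subset cells chi a i by rewrite !ffunE subsetDl.
have Bge i : g * m%:R <= #|B i|%:R.
  have := Lroom a i (mem_head _ _); rewrite big_cons mulnDr natrD => h.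
  have : (#|[set v | chi v == a i]| <= #|B i| + t * \sum_(a' <- L) multiplicity a' (a
    i))%N.
    rewrite -ssc ffunE -(cardsID [set v in flatten ss] [set v | chi v == a i]) addnC
      leq_add2l.
    rewrite -size_filter; apply: leq_trans (card_size _); apply: subset_leq_card.
    by apply/subsetP => v; rewrite !inE mem_filter andbC => /andP[-> ->].
  rewrite -(ler_nat R) natrD => h'.
  have : 0 <= (t * multiplicity a (a i))%:R :> R by rewrite ler0n.
  by move: h h'; lra.
have [|||s [ssz us sG sB]] := @tight_path_in_dense_box r' _ G B m (t * r) Gr.
- by move=> i; apply: leq_trans (cm (a i)); apply: subset_leq_card;
  apply: subset_trans (Bsub i) _; rewrite ffunE.
- by rewrite leq_pmull.
- rewrite -(ltr_nat R); apply: lt_le_trans dense _.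
  have := Lreg a (mem_head _ _) => /forallP/(_ B)/implyP.
  rewrite (_ : edge_tuples :&: box B = [set f in box B | [set f i | i in 'I_r] \in G]);
    last first.
    by apply/setP => f; rewrite !inE andbC.
  move=> h; apply: le_trans (h _); last by apply/forallP => i; rewrite Bsub Bge.
  apply: ler_wpM2l => //; rewrite card_box natr_prod -[r in _ ^+ r]card_ord -prodr_const.
  by apply: ler_prod => i _; rewrite mulr_ge0//=; apply: Bge.
have sBP v : v \in s -> exists2 q, (q < t * r)%N & v = nth v s q /\ v \in B (modr r' q).
  move=> vs; exists (index v s); first by rewrite -ssz index_mem.
  rewrite nth_index//; split=> //; have := sB v (index v s);
    rewrite nth_index// -ssz index_mem.
  exact.
exists (s :: ss); split=> /=.
- rewrite cat_uniq us uss andbT/=; apply/hasPn => v vss; apply/negP => /sBP[q _ [_]].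
  by rewrite ffunE !inE vss.
- by rewrite sss.
- by move=> s'; rewrite inE => /orP[/eqP->|/ssG//].
move=> c; rewrite count_cat ssc big_cons mulnDr; congr (_ + _)%N.
case: s ssz us sG sB sBP => [/esym/eqP|x0 s0]; first by rewrite muln_eq0 eqn0Ngt t0.
set s := x0 :: s0 => ssz us sG sB sBP.
rewrite -sum1_count (big_nth x0) ssz big_mkcond/=.
rewrite (eq_big_nat _ _ (F2 := fun q => ((a (modr r' q) == c) : nat))).
  by rewrite (sum_modr t (fun i => (a i == c) : nat)) /multiplicity -sum1dep_card [in
    RHS]big_mkcond.
move=> q /andP[_ qt]; have := sB x0 q qt; rewrite ffunE !inE => /andP[_ /eqP->].
by case: eqP.
Qed.

End Tilings.

(** * Consequences of fractional covers and packings *)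

Section Duality.
Variables (R : archiRealFieldType) (r' n K : nat) (chi : 'I_n -> 'I_K).
Variables (G : {set {set 'I_n}}).
Local Notation r := r'.+1.
Local Open Scope ring_scope.
Hypothesis Gr : Defs.rgraph r G.

Lemma sum_multiplicity (a : {ffun 'I_r -> 'I_K}) (y : 'I_K -> R) :
  \sum_c (multiplicity a c)%:R * y c = \sum_i y (a i).
Proof.
rewrite (partition_big a predT)//=; apply: eq_bigr => c _.
rewrite (eq_bigr (fun=> y c)) => [|i /eqP->//].
by rewrite sumr_const mulr_natl /multiplicity cardsE.
Qed.

(** Each vertex gets the weight of its class. Edges with a regular colour pattern become heavy and
    fall under the threshold bound; the others are charged to irregular tuples. *)
Lemma card_fractional_cover (reg : pred {ffun 'I_r -> 'I_K}) (y : 'I_K -> R) s :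
  (forall c, 0 <= y c) ->
  (forall a, reg a -> 1 <= \sum_c (multiplicity a c)%:R * y c) ->
  \sum_c #|[set v | chi v == c]|%:R * y c < s.+1%:R ->
  (s.*2.+1 * r.-1 + s.+1 <= n)%N ->
  (#|G| + 'C(n - s, r) <=
     'C(n, r) + #|[set f in edge_tuples r' G | ~~ reg (colors chi f)]|)%N.
Proof.
move=> y0 ycov ys sn; pose w v := y (chi v).
have wV : weight w [set: 'I_n] < s.+1%:R.
  apply: le_lt_trans ys; rewrite le_eqVlt; apply/orP; left; apply/eqP.
  rewrite /weight (partition_big chi predT)//=; apply: eq_bigr => c _.
  rewrite (eq_bigr (fun=> y c)) => [|v /andP[_ /eqP <-]//].
  rewrite sumr_const mulr_natl; congr (_ *+ _); apply: eq_card => v.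
  by rewrite unfold_in /= !inE.
have := @card_heavy_bound R _ w (fun v => y0 (chi v)) s r isT _ wV.
rewrite card_ord => /(_ sn) hb.
set Bad := [set f in _ | _].
suff : (#|G| <= #|heavy w [set: 'I_n] r 1| + #|Bad|)%N.
  by move=> h; apply: leq_trans (leq_add h (leqnn _)) _; rewrite addnAC leq_add2r.
rewrite -(cardsID (heavy w [set: 'I_n] r 1) G) leq_add//.
  by apply: subset_leq_card; apply: subsetIr.
apply: leq_trans (leq_imset_card (fun f : {ffun 'I_r -> 'I_n} => [set f i | i in 'I_r])
  (mem Bad)).
apply: subset_leq_card; apply/subsetP => e; rewrite inE => /andP[eh eG].
have er : #|e| = r by move/forallP: Gr => /(_ e)/implyP/(_ eG)/eqP.
pose f := [ffun i : 'I_r => enum_val (cast_ord (esym er) i)].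
have fe : [set f i | i in 'I_r] = e.
  apply/setP => v; apply/imsetP/idP => [[i _ ->]|ve]; first by rewrite ffunE enum_valP.
  exists (cast_ord er (enum_rank_in ve v)) => //.
  by rewrite ffunE cast_ordK enum_rankK_in.
apply/imsetP; exists f => //; rewrite !inE fe eG/=.
apply: contra eh => /ycov; rewrite sum_multiplicity => h.
rewrite inE subsetT er eqxx/=; apply: le_trans h _.
rewrite /weight -fe big_imset/=; last first.
  by move=> i j _ _; rewrite !ffunE => /enum_val_inj/cast_ord_inj.
by rewrite le_eqVlt; apply/orP; left; apply/eqP/eq_bigr => i _; rewrite !ffunE /w;
  congr (y (chi _)); rewrite ffunE.
Qed.

(** Rounding: a tuple of the support receives [q a] paths on [t * r] vertices, losing at most
    [g * m + t] of its weight, and each path has at least [(t - 1) * r] edges. *)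
Lemma fractional_packing_paths (m t k : nat) (reg : pred {ffun 'I_r -> 'I_K}) (d g S : R)
    (x : {a | reg a} -> R) :
  0 <= d -> 0 <= g -> (0 < t)%N -> (1 < r)%N ->
  (forall c, (#|[set v | chi v == c]| <= m)%N) ->
  (forall a, reg a -> lower_regular (edge_tuples r' G) d (g * m%:R) (cells chi a)) ->
  ((t * r) * (r * m ^ r'))%:R < d * (g * m%:R) ^+ r ->
  (forall a, 0 <= x a) ->
  (forall c, \sum_a x a * (multiplicity (val a) c)%:R <= #|[set v | chi v == c]|%:R) ->
  S <= \sum_a x a ->
  (#|[set a | x a != 0%R]| <= K)%N ->
  t%:R * k%:R <= (t%:R - 1) * r%:R * (S - K%:R * (g * m%:R + t%:R)) ->
  exists2 H, H \in tight_linear_forests r n k & contains_copy G H.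
Proof.
move=> d0 g0 t0 r1 cm regP dense x0 xpack xS xK hk.
pose q a := Num.truncn ((x a - g * m%:R) / t%:R).
have tR : 0 < t%:R :> R by rewrite ltr0n.
(* Positivity of [q a] matters: [truncn] sends negative numbers to 0, where the reserve [g * m]
   would be missing. *)
have tq a : (0 < q a)%N -> t%:R * (q a)%:R <= x a - g * m%:R.
  rewrite /q truncn_gt0 => h; rewrite mulrC -ler_pdivlMr// truncn_le.
  exact: le_trans ler01 h.
have gm0 : 0 <= g * m%:R by rewrite mulr_ge0.
have tqx a : t%:R * (q a)%:R <= x a.
  case: (posnP (q a)) => [->|/tq h]; first by rewrite mulr0.
  by apply: le_trans h _; rewrite gerBl.
have xq a : x a - (g * m%:R + t%:R) <= t%:R * (q a)%:R.
  have := truncnS_gt ((x a - g * m%:R) / t%:R); rewrite -/(q a) ltr_pdivrMr// -natr1 => h.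
  by apply/ltW; move: h; lra.
pose L := flatten [seq nseq (q a) (val a) | a <- enum {: {a | reg a}}].
have sumL (h : {ffun 'I_r -> 'I_K} -> nat) : (\sum_(a <- L) h a = \sum_a q a * h (val
  a))%N.
  rewrite big_flatten big_map big_enum/=; apply: eq_bigr => a _.
  by elim: (q a) => [|j IH]; rewrite ?big_nil// big_cons IH mulSn.
have LP b : b \in L -> exists2 a, val a = b & (0 < q a)%N.
  move=> /flattenP[_ /mapP[a _ ->]]; rewrite mem_nseq => /andP[qa /eqP->].
  by exists a.
have [|||ss [uss sss ssG _]] := @disjoint_tight_paths R r' n K m t chi G d g L d0 g0 Gr
  t0 cm.
- by move=> b /LP[a <- _]; apply: regP; apply: (valP a).
(* The tuple [a] meets the class at least once, so its own reserve of [g * m] stays free there; the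
   other tuples stay within [x]. *)
- move=> b i /LP[a <- qa]; set c := val a i; apply: le_trans (xpack c).
  rewrite natrM sumL natr_sum mulr_sumr (bigD1 a)//= [leRHS](bigD1 a)//= addrAC lerD//.
    have m1 : (1 <= multiplicity (val a) c)%N by apply/card_gt0P; exists i; rewrite inE.
    have M1 : 1 <= (multiplicity (val a) c)%:R :> R by rewrite ler1n.
    have := ler_wpM2r (ler0n R (multiplicity (val a) c)) (tq a qa).
    have := ler_wpM2l gm0 M1; rewrite natrM mulrA mulrBl; lra.
  apply: ler_sum => a' _; rewrite natrM mulrA ler_wpM2r//.
- exact: dense.
apply: (@contains_tight_linear_forest r n k G ss) => //.
  by move=> s /ssG[].
have -> : (\sum_(s <- ss) ((size s).+1 - r) = size L * ((t * r).+1 - r))%N.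
  rewrite big_seq (eq_bigr (fun=> ((t * r).+1 - r)%N)); last by move=> s /ssG[-> _].
  by rewrite -big_seq big_const_seq count_predT iter_addn_0 mulnC sss.
apply: (@leq_trans (size L * ((t - 1) * r))); last by rewrite leq_mul2l mulnBl mul1n;
  apply/orP; right; lia.
have sizeL : S - K%:R * (g * m%:R + t%:R) <= t%:R * (size L)%:R.
  rewrite -sum1_size sumL natr_sum mulr_sumr (eq_bigr (fun a => t%:R * (q a)%:R)) =>
    [|a _]; last by rewrite muln1.
  rewrite (bigID (fun a => x a != 0))/=.
  apply: le_trans (_ : \sum_(a | x a != 0) (x a - (g * m%:R + t%:R)) <= _).
    rewrite sumrB sumr_const -[X in _ <= _ - X]mulr_natl lerB//.
      apply: le_trans xS _;
        rewrite [leLHS](bigID (fun a => x a != 0))/= [X in _ + X]big1 ?addr0// => a.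
      by rewrite negbK => /eqP.
    by rewrite ler_wpM2r ?addr_ge0// ler_nat; move: xK; rewrite cardsE.
  rewrite -[leLHS]addr0; apply: lerD; first by apply: ler_sum => a _; apply: xq.
  by apply: sumr_ge0 => a _; rewrite mulr_ge0.
rewrite -(ler_nat R) -(ler_pM2l tR); apply: le_trans hk _.
rewrite !natrM natrB// [leRHS]mulrA [leRHS]mulrC ler_wpM2l//.
by rewrite mulr_ge0// subr_ge0 ler1n.
Qed.

End Duality.

Local Open Scope ring_scope.

Lemma turan_upper_bound (R : archiRealFieldType) r' (c eps : R) :
  (0 < r')%N -> 0 < c -> c < 1 / 2 -> 0 < eps ->
  exists N, forall n, (N <= n)%N ->
    (turan r'.+1 n (tight_linear_forests r'.+1 n (Num.truncn (c * n%:R))))%:R <=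
    ('C(n, r'.+1))%:R - ('C(n - Num.truncn (c * n%:R / r'.+1%:R), r'.+1))%:R
      + eps * n%:R ^+ r'.+1.
Proof.
move=> r'0 c0 c1 eps0; set r := r'.+1.
have rR : 0 < r%:R :> R by rewrite ltr0n.
have r1R : 1 <= r%:R :> R by rewrite ler1n.
(* The first bound keeps [c + del] below 1/2, the second keeps the errors [2 * d] and [2 * del]
   within [eps]. *)
pose del : R := Num.min ((1 / 2 - c) / 2) (eps / 8).
have del0 : 0 < del by rewrite lt_min; apply/andP; split; lra.
have del1 : del <= (1 / 2 - c) / 2 by rewrite ge_min lexx.
have del2 : del <= eps / 8 by rewrite ge_min lexx orbT.
pose d := eps / 8; have d0 : 0 < d by rewrite /d; lra.
(* As [K * m <= 3 * n], the reserves cost at most a quarter of [del * n] edges. *)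
pose g := del / (12 * r%:R); have g0 : 0 < g by rewrite /g divr_gt0// mulr_gt0.
have gr : g * r%:R * 12 = del by rewrite /g; field; rewrite gt_eqF.
have dg0 : 0 < d * g ^+ r by rewrite mulr_gt0// exprn_gt0.
(* Path ends lose a fraction [1 / t] of the edges, which [t * del > 2] makes affordable. *)
pose t := (Num.bound (2 / del)).+1.
have tdel : 2 < t%:R * del.
  rewrite -ltr_pdivrMr// (lt_trans (archi_boundP _))//; first by rewrite divr_ge0// ltW.
  by rewrite ltr_nat.
have [K0 regK0] := @weak_regularity R r d g d0 g0.
have large (x : R) : 0 <= x -> exists N, forall n, (N <= n)%N -> x < n%:R.
  move=> x0; exists (Num.bound x) => n; rewrite -(ler_nat R).
  exact: lt_le_trans (archi_boundP x0).
(* [N1] serves the size condition of the threshold bound, [N2] the rounding to integers, [N3] the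
   rounding of path numbers, [N4] the density needed for one path. *)
have [N1 hN1] := large (r%:R / (1 / 2 - c)) ltac:(rewrite divr_ge0//; lra).
have [N2 hN2] := large (1 / del) ltac:(rewrite divr_ge0// ltW//).
have [N3 hN3] := large (4 * r%:R * K0%:R * t%:R / del) ltac:(by rewrite divr_ge0
  ?mulr_ge0// ltW).
have [N4 hN4] := large (K0%:R * ((t * r)%:R * r%:R) / (d * g ^+ r)) ltac:(by apply:
  divr_ge0; [rewrite !mulr_ge0|exact: ltW]).
exists (K0 + N1 + N2 + N3 + N4)%N => n hn.
have [l0 l1 l2 l3 l4] : [/\ K0 <= n, N1 <= n, N2 <= n, N3 <= n & N4 <= n]%N.
  by clear -hn; split; lia.
have {hN1} n1 : r%:R < n%:R * (1 / 2 - c).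
  by rewrite -ltr_pdivrMr; [exact: hN1|lra].
have {hN2} n2 : 1 < n%:R * del by rewrite -ltr_pdivrMr//; exact: hN2.
have {hN3} n3 : 4 * r%:R * K0%:R * t%:R < n%:R * del by rewrite -ltr_pdivrMr//;
  exact: hN3.
have {hN4} n4 : K0%:R * ((t * r)%:R * r%:R) < n%:R * (d * g ^+ r) by rewrite
  -ltr_pdivrMr//; exact: hN4.
have n0 : 0 < n%:R :> R by rewrite -(pmulr_lgt0 _ del0) (lt_trans ltr01).
have nr0 : 0 <= n%:R ^+ r' :> R by rewrite exprn_ge0.
set k := Num.truncn (c * n%:R); set s0 := Num.truncn (c * n%:R / r%:R).
have kn : k%:R <= c * n%:R by rewrite truncn_le mulr_ge0// ltW.
rewrite /turan; elim/big_ind: _ => [|a b ha hb|G /andP[Gr noG]].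
- have : ('C(n - s0, r))%:R <= ('C(n, r))%:R :> R by rewrite ler_nat leq_bin2l ?leq_subr.
  have : 0 <= eps * n%:R ^+ r by rewrite mulr_ge0 ?exprn_ge0// ltW.
  by move=> h1 h2; rewrite addr_ge0// subr_ge0.
- by rewrite /maxn; case: ifP.
have [|K [m [chi [KK0 [cm Km bad]]]]] := regK0 'I_n (edge_tuples r' G).
  by rewrite card_ord.
rewrite card_ord in Km bad.
pose reg a := lower_regular (edge_tuples r' G) d (g * m%:R) (cells chi a).
have nKm : (n <= K * m)%N.
  rewrite -[n in (n <= _)%N]card_ord -sum1_card (partition_big chi predT)//=.
  rewrite -[K in (_ <= K * _)%N]card_ord -sum_nat_const; apply: leq_sum => b _.
  by rewrite sum1dep_card; apply: cm.
have nK0m : n%:R <= K0%:R * m%:R :> R.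
  by rewrite -natrM ler_nat; apply: leq_trans nKm _; rewrite leq_mul2r KK0 orbT.
have KmR : K%:R * m%:R <= 3 * n%:R :> R by rewrite -!natrM ler_nat.
have KR : K%:R <= K0%:R :> R by rewrite ler_nat.
have m0 : 0 < m%:R :> R.
  by rewrite lt_neqAle ler0n andbT; apply/eqP => m_0; move: nK0m; rewrite -m_0 mulr0; lra.
have K00 : 0 < K0%:R :> R by rewrite -(pmulr_lgt0 _ m0); apply: lt_le_trans nK0m.
have dense : ((t * r) * (r * m ^ r'))%:R < d * (g * m%:R) ^+ r.
  rewrite exprMn [m%:R ^+ _]exprS mulnA natrM natrX.
  rewrite (_ : d * _ = d * g ^+ r * m%:R * m%:R ^+ r'); last by ring.
  rewrite ltr_pM2r ?exprn_gt0// -(ltr_pM2l K00) natrM; apply: lt_le_trans n4 _.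
  by rewrite mulrC mulrCA ler_pM2l.
pose S : R := (c + del) * n%:R / r%:R.
have S0 : 0 <= S by rewrite /S divr_ge0// mulr_ge0//; lra.
have SE : S * r%:R = (c + del) * n%:R by rewrite /S divfK// gt_eqF.
pose A (a : {a | reg a}) b : R := (multiplicity (val a) b)%:R.
have A0 a b : 0 <= A a b by rewrite /A.
have A1 a : exists b, 0 < A a b.
  by exists (val a ord0); rewrite ltr0n; apply/card_gt0P; exists ord0; rewrite inE.
(* A packing of value [S] produces a forbidden forest in [G]; a cover of cost below [S] bounds
   [#|G|]. *)
case: (@packing_covering_duality R _ _ A (fun b => #|[set v | chi v == b]|%:R) S) => //
  [[x [x0 xpack xS]]|[y [y0 ycov yS]]].
  have [x' [x'0 x'pack x'S x'K]] := packing_basic_solution A0 A1 x0.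
  have [||||H HF HG] := @fractional_packing_paths R r' n K chi G Gr m t k reg d g S x'
    (ltW d0) (ltW g0) isT r'0 cm _ dense x'0 _ (le_trans xS x'S).
  - by [].
  - by move=> b; rewrite x'pack.
  - by rewrite -[K in (_ <= K)%N]card_ord.
  - have h1 : r%:R * (K%:R * (g * m%:R)) <= del * n%:R / 4.
      rewrite (_ : r%:R * _ = g * r%:R * (K%:R * m%:R)); last by ring.
      apply: le_trans (ler_wpM2l _ KmR) _; first by rewrite mulr_ge0// ltW.
      by rewrite -gr le_eqVlt; apply/orP; left; apply/eqP; field.
    have h2 : r%:R * (K%:R * t%:R) <= del * n%:R / 4.
      have : 4 * r%:R * K%:R * t%:R <= 4 * r%:R * K0%:R * t%:R :> R.
        by rewrite ler_wpM2r// ler_wpM2l// mulr_ge0.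
      by move=> h; move: (le_trans h (ltW n3)); rewrite -!mulrA; lra.
    have h3 : (c + del / 2) * n%:R <= r%:R * (S - K%:R * (g * m%:R + t%:R)).
      by rewrite mulrBr mulrDr mulrDr [r%:R * S]mulrC SE; lra.
    have t1 : 0 <= t%:R - 1 :> R by rewrite subr_ge0 ler1n.
    rewrite -mulrA; apply: le_trans (ler_wpM2l t1 h3).
    apply: le_trans (ler_wpM2l (ler0n _ _) kn) _.
    rewrite -subr_ge0 (_ : _ - _ = n%:R * (t%:R * del / 2 - c - del / 2)); last by field.
    by rewrite mulr_ge0//; lra.
  by move/forallP: noG => /(_ H)/implyP/(_ HF)/negP.
pose s := Num.truncn S.
have sS : s%:R <= S by rewrite truncn_le.
have Ss : S < s.+1%:R by apply: truncnS_gt.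
have s0s : (s0 <= s)%N.
  by apply: le_truncn; rewrite /S ler_wpM2r ?invr_ge0// ler_wpM2r//; lra.
have s0S : c * n%:R / r%:R < s0.+1%:R by apply: truncnS_gt.
(* The left side is at most [2 * s * r + r]; here [2 * s * r <= (c + 1 / 2) * n] leaves a gap larger
   than [r]. *)
have sr : (s.*2.+1 * r.-1 + s.+1 <= n)%N.
  have h : s%:R * r%:R <= (c + del) * n%:R by rewrite -SE ler_wpM2r.
  have h' : 2 * (c + del) * n%:R <= (c + 1 / 2) * n%:R by rewrite ler_wpM2r//; lra.
  rewrite -(ler_nat R) natrD natrM -!natr1 -addnn natrD.
  have -> : r.-1%:R = r%:R - 1 :> R by rewrite /r -natr1 addrK.
  have s_ge0 : 0 <= s%:R :> R by [].
  by move: h h' n1; lra.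
have := @card_fractional_cover R r' n K chi G Gr reg y s y0 _ (lt_trans yS Ss) sr.
move=> /(_ (fun a ra => ycov (exist _ a ra))); rewrite -(ler_nat R) !natrD => hG.
have := bin_sub_le n r' s0s; rewrite -(ler_nat R) natrD natrM natrX => hC.
(* Passing from [s] to [s0] shifts by at most [2 * del * n], the rounding being absorbed by
   [1 < n * del]. *)
have : (s - s0)%:R * n%:R ^+ r' <= 2 * del * n%:R ^+ r :> R.
  rewrite exprS mulrA ler_wpM2r// natrB//.
  have h : del * n%:R / r%:R <= del * n%:R by rewrite ler_pdivrMr// ler_peMr//
    mulr_ge0// ltW.
  move: s0S sS n2; rewrite -natr1 /S mulrDl mulrDl; lra.
have := bad; rewrite -/r => hbad.
have : (2 * d + 2 * del) * n%:R ^+ r <= eps * n%:R ^+ r.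
  by rewrite ler_wpM2r ?exprn_ge0//; rewrite /d; lra.
move: hG hC hbad; rewrite -/reg -/r mulrDl; lra.
Qed.

(** The construction requires [r * s < k] strictly, so it is applied with [s0.-1]; returning to [s0]
    costs at most [n ^ r']. *)
Lemma turan_asymptotic_lower_bound (R : archiRealFieldType) r' (c : R) n :
  0 < c -> c <= 1 ->
  ('C(n, r'.+1))%:R - ('C(n - Num.truncn (c * n%:R / r'.+1%:R), r'.+1))%:R - n%:R ^+ r'
  <= (turan r'.+1 n (tight_linear_forests r'.+1 n (Num.truncn (c * n%:R))))%:R :> R.
Proof.
move=> c0 c1; set r := r'.+1; set k := Num.truncn (c * n%:R);
  set s0 := Num.truncn (_ / _).
have rR : 0 < r%:R :> R by rewrite ltr0n.
have cn0 : 0 <= c * n%:R by rewrite mulr_ge0// ltW.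
have s0r : (s0 * r)%:R <= c * n%:R.
  by rewrite natrM -ler_pdivlMr// truncn_le divr_ge0// ltW.
have sk : (s0 * r <= k)%N by rewrite truncn_ge_nat.
have s0n : (s0 <= n)%N.
  apply: (@leq_trans (s0 * r)); first by rewrite leq_pmulr.
  by rewrite -(ler_nat R); apply: le_trans s0r _; rewrite ler_piMl.
case: (posnP s0) => [->|s00].
  by rewrite subn0 subrr sub0r (le_trans (y := 0))// oppr_le0 exprn_ge0.
have rk : (r * s0.-1 < k)%N.
  by apply: leq_trans sk; rewrite mulnC ltn_pmul2r// prednK.
have := @turan_lower_bound r n k s0.-1 (leq_trans (leq_pred _) s0n) rk.
rewrite leq_subLR -(ler_nat R) natrD => h1.
have := @bin_sub_le n s0.-1 s0 r' (leq_pred _).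
rewrite -{3}(prednK s00) subSnn mul1n -(ler_nat R) natrD natrX -/r => h2.
by move: h1 h2; lra.
Qed.

(* The little-o statement *)
From mathcomp Require Import all_classical all_reals all_analysis.
Import numFieldNormedType.Exports.
Local Open Scope classical_set_scope.
Local Open Scope ring_scope.

Theorem theorem4p2 (R : realType) (r : nat) (c : R)
    (hr : (3 <= r)%N) (hc0 : 0 < c) (hc : c < 1 / 2) :
  (fun n : nat =>
     (turan r n (tight_linear_forests r n (Num.truncn (c * n%:R))))%:R : R) =
  (fun n : nat =>
     ('C(n, r))%:R - ('C(n - Num.truncn (c * n%:R / r%:R), r))%:R : R)
  +o_ \oo (fun n : nat => n%:R ^+ r : R).
Proof.
case: r hr => // r hr; apply/eqaddoP => eps eps0.
have [N hN] := turan_upper_bound (ltnW hr : (0 < r)%N) hc0 hc eps0.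
have c1 : c <= 1.
  by apply: ltW; apply: lt_le_trans hc _; rewrite ler_pdivrMr// mul1r ler1n.
(* Once [n] is at least [eps^-1], the lower-order loss [n ^ r] in the lower bound is at most
   [eps * n ^ r.+1]. *)
exists (N + Num.bound eps^-1)%N => // n /= hn.
have nN : (N <= n)%N by apply: leq_trans hn; rewrite leq_addr.
have n_large : 1 <= eps * n%:R.
  rewrite -(ler_pM2l (_ : 0 < eps^-1)) ?invr_gt0// mulr1 mulKf ?gt_eqF//.
  apply: le_trans (ltW (archi_boundP _)) _; first by rewrite invr_ge0 ltW.
  by rewrite ler_nat; apply: leq_trans hn; rewrite leq_addl.
rewrite [X in _ <= _ * X]ger0_norm ?exprn_ge0// ler_norml; apply/andP; split.
  rewrite lerBrDl; apply: le_trans (turan_asymptotic_lower_bound r n hc0 c1).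
  by rewrite lerD2l lerN2 exprS mulrA ler_peMl ?exprn_ge0.
by rewrite lerBlDl; apply: hN.
Qed.
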